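(* Consider the system $x(s+1)=(1-a(s))x(s)+a(s)[P(s)x(s)+u(s)]$, $s=0,1,\ldots$, in $\mathbb{R}^n$ (or the multi-agent system (M) of the context, which is of this form), satisfying (A1) with $u=\mathbf{0}_{n\times1}$ and (A2). Let $S_1,\ldots,S_{r'}$ be a partition of $\{1,\ldots,n\}$. Then $x(s)$ asymptotically reaches $\{S_i\}_{i=1}^{r'}$-group consensus in mean square for any initial state if and only if $\widetilde{\rho}_{\max}(P)<1$, or (A5) holds with $\widetilde{\rho}_{\max}(P)=1$.
   Context: Here $P(s)\in\mathbb{R}^{n\times n}$ and $u(s)\in\mathbb{R}^n$, $s\ge 0$, are random matrices and vectors on a common probability space, $a(s)\in\mathbb{R}$ is the gain, and $x(0)\in\mathbb{R}^n$ is the initial state. System (M): for $1\le i\le n$, $$x_i(s+1)=(1-a(s))x_i(s)+a(s)\sum_{j\in\mathcal{N}_i(s)}P_{ij}(s)\big[x_j(s)+f_{ji}(x(s))w_{ji}(s)\big],$$ where $\mathcal{N}_i(s)$ is the neighbor set of node $i$ at time $s$, $P_{ij}(s)$ is the weight of edge $(j,i)$ at time $s$, and $f_{ji}(x(s))w_{ji}(s)$ is a (state-dependent) noise. Setting $P_{ij}(s)=0$ for $j\notin\mathcal{N}_i(s)$ and $u_i(s):=\sum_{j\in\mathcal{N}_i(s)}P_{ij}(s)f_{ji}(x(s))w_{ji}(s)$, (M) takes the form $x(s+1)=(1-a(s))x(s)+a(s)[P(s)x(s)+u(s)]$. For $A\in\mathbb{R}^{n\times n}$ with eigenvalues $\lambda_i(A)$,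 $\widetilde{\rho}_{\max}(A):=\max_i \mathrm{Re}(\lambda_i(A))$. (A1): there exist a matrix $P\in\mathbb{R}^{n\times n}$ and a vector $u\in\mathbb{R}^n$ such that $\mathbb{E}[P(s)\,|\,x(s)]=P$ and $\mathbb{E}[u(s)\,|\,x(s)]=u$ for any $s\ge 0$ and $x(s)\in\mathbb{R}^n$; also $\mathbb{E}[\|P(s)\|_2^2\,|\,x(s)]$ and $\mathbb{E}[\|u(s)\|_2^2\,|\,x(s)]$ are uniformly bounded. (A2): $\{a(s)\}$ are non-negative real numbers independent of $\{x(s)\}$ with $\sum_{s=0}^\infty a(s)=\infty$ and $\sum_{s=0}^\infty a^2(s)<\infty$. A partition $S_1,\ldots,S_{r'}$ ($r'\ge1$) of $\{1,\ldots,n\}$ consists of nonempty, pairwise disjoint subsets whose union is $\{1,\ldots,n\}$. Let $\mathds{1}^i\in\mathbb{R}^n$ ($1\le i\le r'$) be the column vector with $\mathds{1}^i_k=1$ if $k\in S_i$ and $\mathds{1}^i_k=0$ otherwise; linear combinations of $\{\mathds{1}^i\}$ are taken with complex coefficients. (A5): any eigenvalue of $P$ whose real part is $1$ equals $1$, the algebraic and geometric multiplicities of the eigenvalue $1$ both equal some $r\in[1,r']$, and any right eigenvector of $P$ corresponding to the eigenvalue $1$ can be written as a linear combination of $\{\mathds{1}^i\}_{i=1}^{r'}$. $x(s)$ is mean-square convergent if there is an $n$-dimensional random vector $x$ with $\mathbb{E}\|x\|_2^2<\infty$ and $\lim_{s\to\infty}\mathbb{E}\|x(s)-x\|_2^2=0$.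 $x(s)$ asymptotically reaches $\{S_i\}_{i=1}^{r'}$-group consensus in mean square if $x(s)$ is mean-square convergent and $\lim_{s\to\infty}\mathbb{E}|x_i(s)-x_j(s)|=0$ whenever $i$ and $j$ belong to the same subset of the partition.
   Formalization: In (A1) the conditional means of P(s) and u(s) are taken given the whole state history x(0),...,x(s), not x(s) alone; with x(s) alone the claim fails (n=1, P(s)=1, Gaussian u(s) independent of x(s) that keeps rotating the state, so x(s) does not converge in mean square). *)

(* Defs.v *)
From HB Require Import structures.
From mathcomp Require Import all_boot all_order all_algebra.
From mathcomp Require Import all_classical all_reals all_analysis.
From mathcomp Require Export complex.

Set Implicit Arguments.
Unset Strict Implicit.
Unset Printing Implicit Defensive.

Import Order.TTheory GRing.Theory Num.Theory.
Import numFieldNormedType.Exports.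

Local Open Scope classical_set_scope.
Local Open Scope ring_scope.

Section Norms.
Context (R : realType) (n : nat).

Definition norm2 (v : 'cV[R]_n) : R := Num.sqrt (\sum_i v i 0 ^+ 2).

Definition mxnorm2 (A : 'M[R]_n) : R :=
  sup [set norm2 (A *m v) | v in [set v | norm2 v <= 1]].

End Norms.

Section Spectrum.
Context (R : realType) (n : nat).

Definition mxC (A : 'M[R]_n) : 'M[R[i]]_n := map_mx (real_complex R) A.

(* For 0 < n the set below is finite and nonempty, so the supremum is a
   maximum. *)
Definition rho_max (A : 'M[R]_n) : R :=
  sup [set complex.Re z | z in [set z : R[i] | eigenvalue (mxC A) z]].

Definition alg_mult (A : 'M[R]_n) (z : R[i]) : nat :=
  mup z (char_poly (mxC A)).

(* [eigenspace] consists of row vectors v with v *m B = z *: v; transposing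
   turns it into the space of right eigenvectors. *)
Definition geom_mult (A : 'M[R]_n) (z : R[i]) : nat :=
  \rank (eigenspace (mxC A)^T z).

Definition indicator_vec (B : {set 'I_n}) : 'cV[R[i]]_n :=
  \col_k (k \in B)%:R.

(* Here r' = #|S|. *)
Definition A5 (S : {set {set 'I_n}}) (A : 'M[R]_n) : Prop :=
  [/\ forall z : R[i], eigenvalue (mxC A) z -> complex.Re z = 1 -> z = 1,
      exists r : nat,
        [/\ (1 <= r <= #|S|)%N, alg_mult A 1 = r & geom_mult A 1 = r]
    & forall v : 'cV[R[i]]_n, v != 0 -> mxC A *m v = v ->
        exists c : {set 'I_n} -> R[i],
          v = \sum_(B in S) c B *: indicator_vec B].

End Spectrum.

Section Conditioning.
Context (d : measure_display) (T : measurableType d) (R : realType).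
Context (Pr : probability T R).

(* Z is a version of E[Y | G], for a sub-sigma-algebra G of measurable sets. *)
Definition is_cond_exp (G : set (set T)) (Y Z : T -> R) : Prop :=
  [/\ Pr.-integrable setT (EFin \o Y),
      Pr.-integrable setT (EFin \o Z),
      forall B : set R, measurable B -> G (Z @^-1` B)
    & forall A : set T, G A ->
        (\int[Pr]_(w in A) (Y w)%:E = \int[Pr]_(w in A) (Z w)%:E)%E].

Context (n : nat).

Definition sigma_at (x : nat -> T -> 'cV[R]_n) (s : nat) : set (set T) :=
  g_sigma_preimage (fun (i : 'I_n) w => x s w i 0).

(* sigma(x(0), ..., x(s)) *)
Definition sigma_upto (x : nat -> T -> 'cV[R]_n) (s : nat) : set (set T) :=
  <<s \bigcup_(k in `I_s.+1) sigma_at x k >>.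

(* "Given x(s)" is read, for the conditional means, as given the state
   trajectory up to time s: the past influences the means of P(s) and u(s) only
   through the current state.  With sigma_at x s instead of sigma_upto x s,
   mean-square convergence can fail when rho_max P = 1.  For n = 1, P(s) = 1,
   u(0) = G1, and for s >= 1
     x(s) - x(0) = r_s (G1 cos t_s + G2 sin t_s),
     u(s) = r_s (G2 cos t_s - G1 sin t_s),
     t_1 = 0, t_(s+1) = t_s + atan (a s),
     r_1 = a 0 > 0, r_(s+1) = r_s sqrt (1 + (a s)^2),
   with G1, G2 independent standard Gaussians, u(s) is centered and independent
   of x(s), r_s is bounded, and t_s diverges.
   The second moments only need bounded conditional expectations given x(s). *)
Definition A1 (x : nat -> T -> 'cV[R]_n)
    (Pm : nat -> T -> 'M[R]_n) (u : nat -> T -> 'cV[R]_n)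
    (P : 'M[R]_n) (ubar : 'cV[R]_n) : Prop :=
  [/\ forall s i j,
        is_cond_exp (sigma_upto x s) (fun w => Pm s w i j) (cst (P i j)),
      forall s i,
        is_cond_exp (sigma_upto x s) (fun w => u s w i 0) (cst (ubar i 0))
    & exists C : R, forall s,
        (exists2 Z : T -> R,
           is_cond_exp (sigma_at x s) (fun w => mxnorm2 (Pm s w) ^+ 2) Z &
           {ae Pr, forall w, Z w <= C}) /\
        (exists2 Z : T -> R,
           is_cond_exp (sigma_at x s) (fun w => norm2 (u s w) ^+ 2) Z &
           {ae Pr, forall w, Z w <= C})].

Definition ms_convergent (x : nat -> T -> 'cV[R]_n) : Prop :=
  exists y : T -> 'cV[R]_n,
    [/\ forall i, measurable_fun setT (fun w => y w i 0),
        ('E_Pr[(fun w => norm2 (y w) ^+ 2)%R] < +oo)%E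
      & ('E_Pr[(fun w => norm2 (x s w - y w) ^+ 2)%R] @[s --> \oo] --> 0)%E].

Definition ms_group_consensus (S : {set {set 'I_n}})
    (x : nat -> T -> 'cV[R]_n) : Prop :=
  ms_convergent x /\
  forall B i j, B \in S -> i \in B -> j \in B ->
    ('E_Pr[(fun w => `|x s w i 0 - x s w j 0|)%R] @[s --> \oo] --> 0)%E.

End Conditioning.

Definition A2 (R : realType) (a : nat -> R) : Prop :=
  [/\ forall s, 0 <= a s,
      (\sum_(0 <= s <oo) (a s)%:E = +oo)%E
    & (\sum_(0 <= s <oo) (a s ^+ 2)%:E < +oo)%E].

Definition is_trajectory (T : Type) (R : realType) (n : nat) (a : nat -> R)
    (Pm : nat -> T -> 'M[R]_n) (u : nat -> T -> 'cV[R]_n) (x0 : 'cV[R]_n)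
    (x : nat -> T -> 'cV[R]_n) : Prop :=
  (forall w, x 0%N w = x0) /\
  forall s w,
    x s.+1 w = (1 - a s) *: x s w + a s *: (Pm s w *m x s w + u s w).

(* Main.v *)
Require Import Defs.
From mathcomp Require Import all_boot all_order all_algebra.
From mathcomp Require Import all_classical all_reals all_analysis.
From mathcomp Require Import measurable_realfun spectral ring lra.

(* Write A = P - 1 and x(s+1) = x(s) + a(s) A x(s) + a(s) xi(s), where the noise
   xi(s) = (P(s) - P) x(s) + u(s) is uncorrelated with every square integrable
   function of x(0), ..., x(s) and E|xi(s)|^2 <= K (1 + E|x(s)|^2).

   Sufficiency.  Let Pi be the spectral projection of A on its kernel (Pi = 0
   when rho_max P < 1).  All eigenvalues of A - Pi have negative real part, so a
   quadratic Lyapunov function V of (1 - Pi) x(s) satisfies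
   E V(s+1) <= (1 - 2 c a(s)) E V(s) + O(a(s)^2) (1 + E|x(s)|^2).  Gronwall's
   inequality bounds E|x(s)|^2, whence E V(s) -> 0, while the increments
   a(s) Pi xi(s) of Pi x(s) are orthogonal and square summable, so that Pi x(s)
   converges in L2.  The columns of Pi are eigenvectors of P for the eigenvalue
   1, hence constant on the blocks of the partition.

   Necessity.  The means m(s+1) = m(s) + a(s) A m(s) converge from every initial
   state; since sum a(s) diverges, A m(s) -> 0.  Starting from (the real and
   imaginary parts of) an eigenvector, from v with A (A v) = 0, and from v with
   A v = 0, this gives the conditions on the spectrum, on the multiplicities and
   on the eigenvectors, respectively. *)

(** The second moments of P(s) are controlled only conditionally on x(s), so products such as
    |x(s)|^2 |P(s)|^2 must be shown integrable before their expectations are used. This is done with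
    level sets: an inequality between the integrals of [f] and [g] over a family of events
    containing all {t < X} passes to the integrals weighted by X >= 0.

    Subtracting Pi from A only moves the eigenvalue 0 to -1, and A and A - Pi agree on the range of
    1 - Pi. One Lyapunov lemma for stable matrices thus covers both alternatives of the theorem. Pi
    is explicit: for a rank factorisation A = B C with C B invertible, Pi = 1 - B (C B)^-1 C.
    Invertibility of C B is equivalent to the equality of the two multiplicities of the eigenvalue 1
    of P, and it is also what the necessity part derives from A (A v) = 0 implying A v = 0.

    The Lyapunov estimate for (1 - Pi) x(s) does not close by itself, because the noise depends on
    the whole state; E |Pi x(s)|^2 is therefore carried along in the same recursion. *)

Set Implicit Arguments.
Unset Strict Implicit.
Unset Printing Implicit Defensive.

Import Order.TTheory GRing.Theory Num.Theory.
Import numFieldNormedType.Exports.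

(** * Quadratic forms *)

Section ComplexParts.
Context (R : realType).
Local Open Scope ring_scope.
Implicit Types z t : R[i].

Let Re0 : complex.Re (0 : R[i]) = 0. Proof. by []. Qed.
Let Im0 : complex.Im (0 : R[i]) = 0. Proof. by []. Qed.

Lemma ReD z t : complex.Re (z + t) = complex.Re z + complex.Re t.
Proof. by case: z t => a b [c e]. Qed.

Lemma ImD z t : complex.Im (z + t) = complex.Im z + complex.Im t.
Proof. by case: z t => a b [c e]. Qed.

Lemma ReM z t :
  complex.Re (z * t) = complex.Re z * complex.Re t - complex.Im z * complex.Im t.
Proof. by case: z t => a b [c e]. Qed.

Lemma ImM z t :
  complex.Im (z * t) = complex.Re z * complex.Im t + complex.Im z * complex.Re t.
Proof. by case: z t => a b [c e]. Qed.

Lemma Re_sum I (r : seq I) (Q : pred I) (F : I -> R[i]) :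
  complex.Re (\sum_(i <- r | Q i) F i) = \sum_(i <- r | Q i) complex.Re (F i).
Proof. exact: (big_morph _ ReD Re0). Qed.

Lemma Im_sum I (r : seq I) (Q : pred I) (F : I -> R[i]) :
  complex.Im (\sum_(i <- r | Q i) F i) = \sum_(i <- r | Q i) complex.Im (F i).
Proof. exact: (big_morph _ ImD Im0). Qed.

Definition nsqC z : R := complex.Re z ^+ 2 + complex.Im z ^+ 2.
(** The real part of conj(z) t: the Euclidean inner product of C seen as R^2. *)
Definition dotC z t : R :=
  complex.Re z * complex.Re t + complex.Im z * complex.Im t.

Lemma nsqC_ge0 z : 0 <= nsqC z.
Proof. by rewrite addr_ge0 ?sqr_ge0. Qed.

Lemma nsqCM z t : nsqC (z * t) = nsqC z * nsqC t.
Proof. by rewrite /nsqC ReM ImM; ring. Qed.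

Lemma dotC_sumr I (r : seq I) (Q : pred I) z (F : I -> R[i]) :
  dotC z (\sum_(i <- r | Q i) F i) = \sum_(i <- r | Q i) dotC z (F i).
Proof. by rewrite /dotC Re_sum Im_sum !mulr_sumr -big_split. Qed.

Lemma dotC_mull t z : dotC z (t * z) = complex.Re t * nsqC z.
Proof. by rewrite /dotC /nsqC ReM ImM; ring. Qed.

(** Young's inequality; the difference of the two sides is |e z - t|^2 / (2 e). *)
Lemma dotC_le (e : R) z t : 0 < e ->
  dotC z t <= (e * nsqC z + nsqC t / e) / 2.
Proof.
move=> e0; rewrite -subr_ge0.
suff -> : (e * nsqC z + nsqC t / e) / 2 - dotC z t =
    ((e * complex.Re z - complex.Re t) ^+ 2 +
     (e * complex.Im z - complex.Im t) ^+ 2) / (2 * e).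
  by rewrite divr_ge0 ?addr_ge0 ?sqr_ge0 // mulr_ge0 // ltW.
by rewrite /nsqC /dotC; field; rewrite gt_eqF.
Qed.

End ComplexParts.

Section QuadraticForms.
Context (R : realType).
Local Open Scope ring_scope.

Definition dotv n (u v : 'cV[R]_n) : R := \sum_i u i 0 * v i 0.
Definition nsq n (v : 'cV[R]_n) : R := \sum_i v i 0 ^+ 2.

Lemma nsq_ge0 n (v : 'cV[R]_n) : 0 <= nsq v.
Proof. by apply: sumr_ge0 => i _; rewrite sqr_ge0. Qed.

Lemma norm2_ge0 n (v : 'cV[R]_n) : 0 <= norm2 v.
Proof. exact: sqrtr_ge0. Qed.

Lemma norm2_sqr n (v : 'cV[R]_n) : norm2 v ^+ 2 = nsq v.
Proof. by rewrite sqr_sqrtr // nsq_ge0. Qed.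

Lemma dotv_nsq n (v : 'cV[R]_n) : dotv v v = nsq v.
Proof. by apply: eq_bigr => i _; rewrite expr2. Qed.

Lemma nsqDZ n (c : R) (u v : 'cV[R]_n) :
  nsq (u + c *: v) = nsq u + 2 * c * dotv u v + c ^+ 2 * nsq v.
Proof.
rewrite /nsq /dotv !mulr_sumr -!big_split /=.
by apply: eq_bigr => i _; rewrite !mxE; ring.
Qed.

Lemma nsqD_le n (u v : 'cV[R]_n) : nsq (u + v) <= 2 * nsq u + 2 * nsq v.
Proof.
rewrite /nsq !mulr_sumr -big_split /=; apply: ler_sum => i _; rewrite mxE.
by rewrite -subr_ge0 (_ : _ - _ = (u i 0 - v i 0) ^+ 2) ?sqr_ge0 //; ring.
Qed.

Lemma coord_sqr_le n (v : 'cV[R]_n) i : v i 0 ^+ 2 <= nsq v.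
Proof.
rewrite /nsq (bigD1 i) //= lerDl.
by apply: sumr_ge0 => j _; rewrite sqr_ge0.
Qed.

Lemma dotv_le n (u v : 'cV[R]_n) : 2 * dotv u v <= nsq u + nsq v.
Proof.
rewrite /nsq /dotv mulr_sumr -big_split /=; apply: ler_sum => i _.
by rewrite -subr_ge0 (_ : _ - _ = (u i 0 - v i 0) ^+ 2) ?sqr_ge0 //; ring.
Qed.

Lemma dotv_CS n (u v : 'cV[R]_n) : dotv u v ^+ 2 <= nsq u * nsq v.
Proof.
have [v0|vN0] := eqVneq (nsq v) 0.
  have vi0 i : v i 0 = 0.
    apply/eqP; rewrite -sqrf_eq0 eq_le sqr_ge0 andbT -v0.
    exact: coord_sqr_le.
  by rewrite /dotv big1 ?expr0n ?v0 ?mulr0 // => i _; rewrite vi0 mulr0.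
have v_gt0 : 0 < nsq v by rewrite lt_def vN0 nsq_ge0.
(* The residual of the orthogonal projection of [u] on [v] has a nonnegative square norm. *)
have := nsq_ge0 (u + (- (dotv u v / nsq v)) *: v); rewrite nsqDZ.
suff -> : nsq u + 2 * - (dotv u v / nsq v) * dotv u v +
    (- (dotv u v / nsq v)) ^+ 2 * nsq v =
    (nsq u * nsq v - dotv u v ^+ 2) / nsq v.
  by rewrite pmulr_lge0 ?invr_gt0 // subr_ge0.
by field.
Qed.

Lemma nsq_mulmx_le m n (A : 'M[R]_(m, n)) (v : 'cV[R]_n) :
  nsq (A *m v) <= (\sum_i \sum_j A i j ^+ 2) * nsq v.
Proof.
rewrite /nsq mulr_suml; apply: ler_sum => i _; rewrite mxE.
have := dotv_CS (\col_j A i j) v.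
rewrite /dotv /nsq.
under eq_bigr do rewrite mxE.
by under [X in _ <= X * _]eq_bigr do rewrite mxE.
Qed.

Lemma nsq_mulmx m n (A : 'M[R]_(m, n)) :
  exists2 K : R, 0 <= K & forall v, nsq (A *m v) <= K * nsq v.
Proof.
exists (\sum_i \sum_j A i j ^+ 2); last exact: nsq_mulmx_le.
by apply: sumr_ge0 => i _; apply: sumr_ge0 => j _; rewrite sqr_ge0.
Qed.

Lemma norm2_mulmx_le n (A : 'M[R]_n) (v : 'cV[R]_n) :
  norm2 (A *m v) <= mxnorm2 A * norm2 v.
Proof.
have [v0|vN0] := eqVneq (norm2 v) 0.
  rewrite v0 mulr0 -[leLHS]sqr_sqrtr ?norm2_ge0 //.
  have [K K0 le_K] := nsq_mulmx A.
  have := le_K v; rewrite -!norm2_sqr v0 expr0n /= mulr0 => h.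
  have : norm2 (A *m v) ^+ 2 == 0 by rewrite eq_le h sqr_ge0.
  by rewrite sqrf_eq0 => /eqP ->; rewrite sqrtr0 expr0n.
have v_gt0 : 0 < norm2 v by rewrite lt_def vN0 norm2_ge0.
have nZ (c : R) (w : 'cV[R]_n) : 0 <= c -> norm2 (c *: w) = c * norm2 w.
  move=> c0; rewrite -[c in RHS]ger0_norm // -sqrtr_sqr -sqrtrM ?sqr_ge0 //.
  congr (Num.sqrt _); rewrite mulr_sumr; apply: eq_bigr => i _.
  by rewrite mxE exprMn.
rewrite -ler_pdivrMr // mulrC -nZ ?invr_ge0 ?norm2_ge0 // scalemxAr.
apply: sup_upper_bound; last first.
  by exists ((norm2 v)^-1 *: v) => //=; rewrite nZ ?invr_ge0 ?norm2_ge0 // mulVf.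
(* [sup_upper_bound] asks for a nonempty bounded set; the bound comes from the Frobenius norm of
   [A]. *)
split.
  exists (norm2 (A *m 0)); exists 0 => //=.
  by rewrite /norm2 big1 ?sqrtr0 // => i _; rewrite mxE expr0n.
have [K K0 le_K] := nsq_mulmx A; exists (Num.sqrt K) => _ [w /= w1 <-].
rewrite ler_sqrt //; apply: (le_trans (le_K w)).
by rewrite ler_piMr // -norm2_sqr exprn_ile1 // norm2_ge0.
Qed.

Lemma nsq_mulmx_norm n (A : 'M[R]_n) (v : 'cV[R]_n) :
  nsq (A *m v) <= mxnorm2 A ^+ 2 * nsq v.
Proof.
rewrite -!norm2_sqr -exprMn lerXn2r ?nnegrE ?norm2_ge0 //; last exact: norm2_mulmx_le.
by apply: le_trans (norm2_mulmx_le A v); exact: norm2_ge0.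
Qed.

Lemma coord_le_mxnorm2 n (A : 'M[R]_n) i j : A i j ^+ 2 <= mxnorm2 A ^+ 2.
Proof.
have := nsq_mulmx_norm A (delta_mx j 0); rewrite -colE.
have -> : nsq (delta_mx j 0 : 'cV[R]_n) = 1.
  rewrite /nsq (bigD1 j) //= !mxE !eqxx expr1n big1 ?addr0 // => k kj.
  by rewrite !mxE (negPf kj) expr0n.
by rewrite mulr1; apply: le_trans; have := coord_sqr_le (col j A) i; rewrite mxE.
Qed.

End QuadraticForms.

(** * Lyapunov functions of stable matrices *)

Section Lyapunov.
Context (R : realType).
Local Open Scope ring_scope.

(* The weights decay so fast that the strictly lower triangular part of [T] is
   absorbed by the diagonal. *)
Lemma trig_lyapunov n (T : 'M[R[i]]_n) (delta : R) : 0 < delta ->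
  is_trig_mx T -> (forall i, complex.Re (T i i) <= - delta) ->
  exists w : 'I_n -> R, (forall i, 0 < w i) /\ exists2 c : R, 0 < c &
    forall y : 'cV[R[i]]_n,
      \sum_i w i * dotC (y i 0) ((T *m y) i 0) <=
      - c * \sum_i w i * nsqC (y i 0).
Proof.
move=> delta0 /is_trig_mxP Ttrig Tdiag.
pose M := \sum_i \sum_j nsqC (T i j).
have M0 : 0 <= M by apply: sumr_ge0 => i _; apply: sumr_ge0 => j _; exact: nsqC_ge0.
have T_M i j : nsqC (T i j) <= M.
  rewrite /M (bigD1 i) //= (bigD1 j) //= -addrA lerDl addr_ge0 //.
    by apply: sumr_ge0 => k _; exact: nsqC_ge0.
  by apply: sumr_ge0 => k _; apply: sumr_ge0 => l _; exact: nsqC_ge0.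
pose N : R := n.+1%:R; have N0 : 0 < N by rewrite ltr0n.
(* [K] is [M / (2 * e)] for the weight [e = delta / N] of Young's inequality below. *)
have [K K0 KE] : exists2 K : R, 0 <= K & K = N * M / (2 * delta).
  by eexists; [|reflexivity]; rewrite divr_ge0 ?mulr_ge0 // ltW.
(* Chosen so that [K * (N * theta) <= delta / 4]; the summand [delta] keeps the denominator positive
   when [K = 0] and ensures [theta <= 1]. *)
pose theta := delta / (4 * K * N + delta).
have den0 : 0 < 4 * K * N + delta.
  by rewrite ltr_wpDl ?mulr_ge0 // ltW.
have theta0 : 0 < theta by rewrite divr_gt0.
have theta1 : theta <= 1.
  by rewrite ler_pdivrMr // mul1r lerDr !mulr_ge0 // ltW.
have thetaK : K * (N * theta) <= delta / 4.
  rewrite /theta mulrA mulrA ler_pdivrMr // -subr_ge0.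
  suff -> : delta / 4 * (4 * K * N + delta) - K * N * delta = delta ^+ 2 / 4.
    by rewrite divr_ge0 ?sqr_ge0.
  by field.
exists (fun i => theta ^+ i); split=> [i|]; first exact: exprn_gt0.
exists (delta / 4) => [|y]; first by rewrite divr_gt0.
pose q (i : 'I_n) := nsqC (y i 0).
have q0 i : 0 <= q i := nsqC_ge0 _.
(* Young's inequality spends half of the diagonal decay [delta] and leaves a multiple of the entries
   of smaller index. *)
have row_le i : dotC (y i 0) ((T *m y) i 0) <=
    - (delta / 2) * q i + K * \sum_(j < n | (j < i)%N) q j.
  rewrite mxE dotC_sumr (bigD1 i) //= dotC_mull.
  have lowE : \sum_(j | j != i) dotC (y i 0) (T i j * y j 0) =
      \sum_(j < n | (j < i)%N) dotC (y i 0) (T i j * y j 0).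
    rewrite (bigID (fun j : 'I_n => (j < i)%N)) /= [X in _ + X]big1 ?addr0.
      apply: eq_bigl => j; case: (ltnP j i) => [ji|]; last by rewrite andbF.
      by rewrite andbT -val_eqE /= ltn_eqF.
    move=> j /andP[ji]; rewrite -leqNgt leq_eqVlt val_eqE eq_sym (negPf ji) /=.
    by move=> ij; rewrite Ttrig // mul0r /dotC !mulr0 addr0.
  rewrite lowE.
  have e0 : 0 < delta / N by rewrite divr_gt0.
  have low_le : \sum_(j < n | (j < i)%N) dotC (y i 0) (T i j * y j 0) <=
      \sum_(j < n | (j < i)%N) (delta / N / 2 * q i + K * q j).
    apply: ler_sum => j ji; apply: (le_trans (dotC_le _ _ e0)).
    rewrite mulrDl mulrAC lerD // nsqCM.
    have -> : K * q j = M * q j / (delta / N) / 2.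
      by rewrite KE; field; rewrite !gt_eqF.
    rewrite ler_pM2r ?invr_gt0 // ler_pM2r ?invr_gt0 //.
    exact: ler_wpM2r (q0 j) _ _ (T_M i j).
  have diag_le : complex.Re (T i i) * nsqC (y i 0) <= - delta * q i.
    exact: ler_wpM2r (q0 i) _ _ (Tdiag i).
  have cst_le : \sum_(j < n | (j < i)%N) delta / N / 2 * q i <= delta / 2 * q i.
    rewrite sumr_const -[leLHS]mulr_natl.
    have le_nN : (#|[pred j : 'I_n | (j < i)%N]|)%:R <= N.
      by rewrite ler_nat (leq_trans (max_card _)) // card_ord.
    have -> : delta / 2 * q i = N * (delta / N / 2 * q i).
      by field; rewrite gt_eqF.
    by rewrite ler_wpM2r // mulr_ge0 // divr_ge0 // ltW.
  apply: (le_trans (lerD diag_le low_le)).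
  rewrite big_split /= -[X in _ + (_ + X)]mulr_sumr.
  by lra.
apply: (@le_trans _ _ (\sum_(i < n) theta ^+ i *
    (- (delta / 2) * q i + K * \sum_(j < n | (j < i)%N) q j))).
  by apply: ler_sum => i _; rewrite ler_pM2l ?exprn_gt0.
under eq_bigr do rewrite mulrDr.
rewrite big_split /=.
have -> : \sum_(i < n) theta ^+ i * (K * \sum_(j < n | (j < i)%N) q j) =
    \sum_(j < n) K * q j * \sum_(i < n | (j < i)%N) theta ^+ i.
  under eq_bigr do rewrite mulrCA mulr_sumr mulr_sumr.
  under [in RHS]eq_bigr do rewrite mulr_sumr.
  rewrite (exchange_big_dep predT) //=.
  by apply: eq_bigr => j _; apply: eq_bigr => i _; ring.
(* After the exchange of sums, [q j] carries the weights of the indices above [j], each at most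
   [theta * theta ^+ j]. *)
have tail_le (j : 'I_n) : \sum_(i < n | (j < i)%N) theta ^+ i <= N * theta * theta ^+ j.
  apply: (@le_trans _ _ (\sum_(i < n | (j < i)%N) theta ^+ j.+1)).
    by apply: ler_sum => i ji; rewrite ler_wiXn2l // ltW.
  rewrite sumr_const -[leLHS]mulr_natl exprS mulrA.
  rewrite ler_pM2r ?exprn_gt0 // ler_pM2r // ler_nat.
  by rewrite (leq_trans (max_card _)) // card_ord.
apply: (@le_trans _ _ (\sum_(i < n) theta ^+ i * (- (delta / 2) * q i) +
    \sum_(j < n) delta / 4 * (theta ^+ j * q j))).
  rewrite lerD2l; apply: ler_sum => j _.
  apply: (@le_trans _ _ (K * q j * (N * theta * theta ^+ j))).
    by rewrite ler_wpM2l // mulr_ge0.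
  have -> : K * q j * (N * theta * theta ^+ j) =
      K * (N * theta) * (theta ^+ j * q j) by ring.
  by rewrite ler_wpM2r // mulr_ge0 // exprn_ge0 // ltW.
rewrite -big_split mulr_sumr /= le_eqVlt; apply/predU1P; left.
by apply: eq_bigr => i _; rewrite -/(q i); field.
Qed.

(** [Q^T Q] solves a Lyapunov inequality for [B]. Keeping the factor [Q] makes the Lyapunov function
    a squared Euclidean norm of a linear image, to which the one-step identity for [D *m x s w] will
    apply. It comes from the lower triangular Schur form of [B] over the complex numbers. *)
Lemma lyapunov n (B : 'M[R]_n) :
  (forall z, eigenvalue (mxC B) z -> complex.Re z < 0) ->
  exists Q : 'M[R]_(n + n, n), exists c k : R,
    [/\ 0 < c, 0 < k,
        forall v, k * nsq v <= nsq (Q *m v)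
      & forall v, dotv (Q *m v) (Q *m (B *m v)) <= - c * nsq (Q *m v)].
Proof.
case: n B => [|n] B stable.
  exists 0, 1, 1; split=> // v; first by rewrite /nsq !big_ord0 mulr0.
  by rewrite /nsq /dotv !big_ord0 mulr0.
have [U U_unitary trigT] := Schur (mxC B) (ltn0Sn n).
have U_unit := unitarymx_unit U_unitary.
rewrite /similar_to /= conjumx // in trigT.
set T := U *m _ *m _ in trigT.
have UB : U *m mxC B = T *m U by rewrite /T mulmxKV.
have ReT i : complex.Re (T i i) < 0.
  apply: stable.
  have : eigenvalue T (T i i).
    rewrite eigenvalue_root_char char_poly_trig // rootE horner_prod.
    by rewrite (bigD1 i) //= hornerXsubC subrr mul0r.
  case/eigenvalueP=> v vT v0; apply/eigenvalueP; exists (v *m U).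
    by rewrite -mulmxA UB mulmxA vT scalemxAl.
  by apply: contra v0 => /eqP vU; rewrite -(mulmxK U_unit v) vU mul0mx.
have [delta delta0 Tdelta] :
    exists2 delta : R, 0 < delta & forall i, complex.Re (T i i) <= - delta.
  case: (@Order.TotalTheory.arg_maxP _ _ _ ord0 predT (fun i => complex.Re (T i i))) => // i _ maxi.
  exists (- complex.Re (T i i)); first by rewrite oppr_gt0.
  by move=> j; rewrite opprK; exact: maxi.
have [w [w0 [c c0 lyapT]]] := trig_lyapunov delta0 trigT Tdelta.
pose toC (v : 'cV[R]_n.+1) := map_mx (real_complex R) v.
(* Real and imaginary parts of [U] are stacked, with rows scaled by sqrt(w i), so that |Q v|^2 is
   the sum of the w i |(U v) i|^2. *)
pose Q := col_mx (\matrix_(i, j) (Num.sqrt (w i) * complex.Re (U i j)))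
                 (\matrix_(i, j) (Num.sqrt (w i) * complex.Im (U i j))).
have dotQ u v : dotv (Q *m u) (Q *m v) =
    \sum_i w i * dotC ((U *m toC u) i 0) ((U *m toC v) i 0).
  have QRe (z : 'cV[R]_n.+1) i :
      (Q *m z) (lshift _ i) 0 = Num.sqrt (w i) * complex.Re ((U *m toC z) i 0).
    rewrite mul_col_mx col_mxEu !mxE Re_sum mulr_sumr; apply: eq_bigr => j _.
    by rewrite ReM !mxE /= mulr0 subr0 mulrA.
  have QIm (z : 'cV[R]_n.+1) i :
      (Q *m z) (rshift _ i) 0 = Num.sqrt (w i) * complex.Im ((U *m toC z) i 0).
    rewrite mul_col_mx col_mxEd !mxE Im_sum mulr_sumr; apply: eq_bigr => j _.
    by rewrite ImM !mxE /= mulr0 add0r mulrA.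
  rewrite /dotv big_split_ord /= -big_split /=; apply: eq_bigr => i _.
  rewrite !QRe !QIm mulrACA [X in _ + X]mulrACA -!expr2.
  by rewrite sqr_sqrtr ?ltW // -mulrDr.
have nsqQ v : nsq (Q *m v) = \sum_i w i * nsqC ((U *m toC v) i 0).
  rewrite -dotv_nsq dotQ; apply: eq_bigr => i _.
  by rewrite /dotC /nsqC !expr2.
have Q_inj (v : 'cV[R]_n.+1) : Q *m v = 0 -> v = 0.
  move=> Qv0.
  have : \sum_i w i * nsqC ((U *m toC v) i 0) == 0.
    by rewrite -nsqQ Qv0 /nsq big1 // => i _; rewrite mxE expr0n.
  rewrite psumr_eq0 => [|i _]; last by rewrite mulr_ge0 ?nsqC_ge0 ?ltW.
  move=> /allP Uv0.
  have {}Uv0 : U *m toC v = 0.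
    apply/matrixP => i j; rewrite ord1 [RHS]mxE.
    have := Uv0 i (mem_index_enum _).
    rewrite mulf_eq0 gt_eqF //= /nsqC paddr_eq0 ?sqr_ge0 // !sqrf_eq0.
    by case: (_ i 0) => a b /= /andP[/eqP -> /eqP ->].
  have : toC v = 0 by rewrite -(mulKmx U_unit (toC v)) Uv0 mulmx0.
  move=> /matrixP v0; apply/matrixP => i j.
  by have := v0 i j; rewrite !mxE => -[].
(* Being injective, [Q] has a left inverse; a bound [K] for this inverse yields the coercivity
   constant, and adding 1 keeps it positive even for [K = 0]. *)
have : row_free Q^T.
  apply: inj_row_free => v vQ; apply: trmx_inj; rewrite trmx0; apply: Q_inj.
  by apply: trmx_inj; rewrite trmx_mul trmxK vQ trmx0.
move=> /mulmxVp QL.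
have LQ (v : 'cV[R]_n.+1) : (pinvmx Q^T)^T *m (Q *m v) = v.
  rewrite mulmxA (_ : _ *m Q = 1%:M) ?mul1mx //.
  by apply: trmx_inj; rewrite trmx_mul trmxK trmx1.
have [K K0 le_K] := nsq_mulmx (pinvmx Q^T)^T.
exists Q, c, (K + 1)^-1; split=> // [|v|v].
- by rewrite invr_gt0 ltr_wpDl.
- rewrite mulrC ler_pdivrMr ?ltr_wpDl //.
  rewrite -{1}(LQ v); apply: (le_trans (le_K _)).
  by rewrite mulrC ler_wpM2l ?nsq_ge0 // lerDl.
rewrite dotQ nsqQ.
have -> : toC (B *m v) = mxC B *m toC v by rewrite /toC map_mxM.
by rewrite mulmxA UB -mulmxA; exact: lyapT.
Qed.
End Lyapunov.

(** * Spectral projection on the kernel *)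

Section Spectrum.
Context (R : realType).
Local Open Scope ring_scope.

Lemma eigenvalue_unitmx (F : fieldType) n (g : 'M[F]_n) a :
  eigenvalue g a = (g - a%:M \notin unitmx).
Proof. by rewrite -row_free_unit -kermx_eq0. Qed.

Lemma eigenvalue_tr (F : fieldType) n (g : 'M[F]_n) a :
  eigenvalue g^T a = eigenvalue g a.
Proof.
rewrite !eigenvalue_unitmx -[in RHS]unitmx_tr linearB /=.
by rewrite tr_scalar_mx.
Qed.

Lemma right_eigenvalueP (F : fieldType) n (g : 'M[F]_n) a :
  reflect (exists2 v : 'cV_n, g *m v = a *: v & v != 0) (eigenvalue g a).
Proof.
rewrite -eigenvalue_tr; apply: (iffP eigenvalueP) => -[v gv v0].
  exists v^T; last by rewrite -trmx0 (inj_eq trmx_inj).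
  by apply: trmx_inj; rewrite trmx_mul trmxK gv linearZ /= trmxK.
exists v^T; last by rewrite -trmx0 (inj_eq trmx_inj).
by rewrite -trmx_mul gv linearZ.
Qed.

Lemma mulmx_Re n (A : 'M[R]_n) (v : 'cV[R[i]]_n) :
  A *m map_mx (@complex.Re R) v = map_mx (@complex.Re R) (mxC A *m v).
Proof.
apply/matrixP => i j; rewrite !mxE Re_sum; apply: eq_bigr => k _.
by rewrite ReM !mxE /= mul0r subr0.
Qed.

Lemma mulmx_Im n (A : 'M[R]_n) (v : 'cV[R[i]]_n) :
  A *m map_mx (@complex.Im R) v = map_mx (@complex.Im R) (mxC A *m v).
Proof.
apply/matrixP => i j; rewrite !mxE Im_sum; apply: eq_bigr => k _.
by rewrite ImM !mxE /= mul0r addr0.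
Qed.

Lemma mxC_sub1 n (P : 'M[R]_n) : mxC (P - 1%:M) = mxC P - 1%:M.
Proof. by rewrite /mxC map_mxB map_mx1. Qed.

Lemma eigenvalue_sub1 n (P : 'M[R]_n) z :
  eigenvalue (mxC (P - 1%:M)) z = eigenvalue (mxC P) (z + 1).
Proof.
by rewrite !eigenvalue_unitmx mxC_sub1 [in RHS]raddfD opprD /= addrAC addrA.
Qed.

Lemma rho_maxP n (P : 'M[R]_n) : (0 < n)%N ->
  (exists2 z, eigenvalue (mxC P) z & complex.Re z = rho_max P) /\
  forall z, eigenvalue (mxC P) z -> complex.Re z <= rho_max P.
Proof.
move=> n0; have [r pE] := closed_field_poly_normal (char_poly (mxC P)).
have eigE z : eigenvalue (mxC P) z = (z \in r).
  rewrite eigenvalue_root_char pE (monicP (char_poly_monic _)) scale1r.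
  exact: root_prod_XsubC.
(* [0 < n] makes the characteristic polynomial nonconstant, so it has a root. *)
have r0 : (0 < size r)%N.
  rewrite -ltnS -(size_prod_XsubC r id) -[\prod_(_ <- _) _]scale1r.
  by rewrite -(monicP (char_poly_monic (mxC P))) -pE size_char_poly ltnS.
pose F (i : 'I_(size r)) := complex.Re r`_i.
have [z0 z0r maxz0] :
    exists2 z0, z0 \in r & forall z, z \in r -> complex.Re z <= complex.Re z0.
  case: (@Order.TotalTheory.arg_maxP _ _ _ (Ordinal r0) predT F) => // i _ maxi.
  exists r`_i; first exact: mem_nth.
  by move=> z /(nthP 0)[k kr <-]; exact: maxi (Ordinal kr) isT.
have rhoE : rho_max P = complex.Re z0.
  apply/eqP; rewrite eq_le; apply/andP; split.
    apply: sup_le_ub; first by exists (complex.Re z0), z0 => //=; rewrite eigE.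
    by move=> _ [z /= + <-]; rewrite eigE => /maxz0.
  apply: sup_upper_bound; last by exists z0 => //=; rewrite eigE.
  split; first by exists (complex.Re z0), z0 => //=; rewrite eigE.
  by exists (complex.Re z0) => _ [z /= + <-]; rewrite eigE => /maxz0.
split; first by exists z0; rewrite ?eigE ?rhoE.
by move=> z; rewrite eigE rhoE => /maxz0.
Qed.

(** Sylvester's determinant identity: both sides are [p ^+ k] times the determinant of one block
    matrix, computed by clearing a block from the right or from the left. The powers of [p] stand in
    for a division, since [p] will be the polynomial X - 1. *)
Lemma det_sylvester (K : comNzRingType) n k (p : K) (B : 'M[K]_(n, k)) (C : 'M[K]_(k, n)) :
  p ^+ k * \det (p%:M - B *m C) = p ^+ n * \det (p%:M - C *m B).
Proof.
pose X := block_mx p%:M B C 1%:M.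
have detL : \det X = \det (p%:M - B *m C).
  transitivity (\det (X *m block_mx 1%:M 0 (- C) 1%:M)).
    by rewrite det_mulmx det_lblock !det1 !mulr1.
  rewrite mulmx_block !mulmx1 !mulmx0 !mul1mx mulmxN !add0r addrN.
  by rewrite det_ublock det1 mulr1.
have detR : p ^+ k * \det X = p ^+ n * \det (p%:M - C *m B).
  transitivity (\det (block_mx 1%:M 0 (- C) p%:M *m X)).
    by rewrite det_mulmx det_lblock det1 mul1r det_scalar.
  rewrite mulmx_block !mul1mx !mul0mx !mulmx1 !addr0 mulNmx mul_mx_scalar.
  rewrite mul_scalar_mx addNr mulNmx addrC.
  by rewrite det_ublock det_scalar.
by rewrite -detL detR.
Qed.

(** With A = B C of rank k, Sylvester's identity at p = X - 1 reads p^k char_poly(P) = p^n det(p - C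
    B). Comparing orders at 1, the algebraic multiplicity is n - k plus the order of det(p - C B),
    and the value of this determinant at 1 is det(- C B). *)
Lemma alg_geom_mult n (P : 'M[R]_n) (A := P - 1%:M) :
  geom_mult P 1 = (n - \rank A)%N /\
  (alg_mult P 1 = geom_mult P 1 <-> row_base A *m col_base A \in unitmx).
Proof.
have geomE : geom_mult P 1 = (n - \rank A)%N.
  rewrite /geom_mult /eigenspace mxrank_ker -(mxrank_map (real_complex R) A).
  rewrite -[in RHS]mxrank_tr -/(mxC A) mxC_sub1 linearB /= tr_scalar_mx.
  by [].
split=> //; set C := row_base A; set B := col_base A.
pose k := \rank A.
pose x : {poly R[i]} := 'X - 1%:P.
have xn0 m : x ^+ m != 0 by rewrite expf_neq0 // polyXsubC_eq0.
pose PC (m l : nat) (D : 'M[R]_(m, l)) := map_mx polyC (map_mx (real_complex R) D).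
have charE : char_poly (mxC P) = \det (x%:M - PC _ _ B *m PC _ _ C).
  congr (\det _); rewrite /char_poly_mx /PC -!map_mxM mulmx_base.
  rewrite -/(mxC A) mxC_sub1 map_mxB map_mx1 /x polyC1.
  by rewrite raddfB /= opprB addrA subrK.
pose q := \det (x%:M - PC _ _ C *m PC _ _ B).
have root_q : root q 1 = (C *m B \notin unitmx).
  rewrite rootE /q -horner_evalE -det_map_mx.
  have -> : map_mx (horner_eval 1) (x%:M - PC _ _ C *m PC _ _ B) =
      - mxC (C *m B).
    rewrite map_mxB map_scalar_mx /= /horner_eval /x hornerXsubC subrr.
    rewrite raddf0 sub0r; congr (- _); rewrite /mxC /PC -!map_mxM -map_mx_comp.
    by apply/matrixP => i j; rewrite !mxE /= hornerC.
  rewrite -scaleN1r detZ mulf_eq0 expf_eq0 oppr_eq0 oner_eq0 andbF /=.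
  by rewrite /mxC det_map_mx fmorph_eq0 unitmxE unitfE negbK.
have [q0|qn0] := eqVneq q 0.
  have : char_poly (mxC P) == 0.
    rewrite -(mulrI_eq0 _ (mulfI (xn0 k))) charE det_sylvester.
    by rewrite -/q q0 mulr0.
  by rewrite (negPf (monic_neq0 (char_poly_monic _))).
have charn0 : char_poly (mxC P) != 0 := monic_neq0 (char_poly_monic _).
have algE : (k + alg_mult P 1%R = n + mup 1%R q)%N.
  have := congr1 (mup 1) (det_sylvester x (PC _ _ B) (PC _ _ C)).
  rewrite -charE -/q !mupM ?xn0 // /x !mup_XsubCX eqxx.
  by [].
have kn : (k <= n)%N by exact: rank_leq_row.
rewrite geomE -/k; split => [algk|].
  have : mup 1 q = 0%N.
    move: algE; rewrite algk subnKC // -[X in X = _]addn0 => /addnI.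
    by move<-.
  move=> mup0; rewrite -[_ \in _]negbK -root_q.
  apply/negP => /factor_theorem[q' qE].
  have := mup_geq 1 1 qn0; rewrite mup0 expr1 /= => /esym/negP; apply.
  by rewrite qE dvdp_mull.
move=> CB; have /mupNroot mup0 : ~~ root q 1 by rewrite root_q CB.
by apply/eqP; rewrite -(eqn_add2l k) algE mup0 addn0 subnKC.
Qed.

(** B (C B)^-1 C projects onto the range of [A] along its kernel, so its complement [Pi] projects
    onto the kernel along the range. *)
Lemma spectral_projection n (P : 'M[R]_n) (A := P - 1%:M) :
  (forall z, eigenvalue (mxC P) z -> complex.Re z < 1 \/ z = 1) ->
  alg_mult P 1 = geom_mult P 1 ->
  exists Pi : 'M[R]_n,
    [/\ A *m Pi = 0, Pi *m A = 0, Pi *m Pi = Pi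
      & forall z, eigenvalue (mxC (A - Pi)) z -> complex.Re z < 0].
Proof.
move=> spec alg_geom.
have [k [B [C [AE CBu]]]] : exists k (B : 'M[R]_(n, k)) (C : 'M[R]_(k, n)),
    A = B *m C /\ C *m B \in unitmx.
  exists (\rank A), (col_base A), (row_base A); rewrite mulmx_base; split=> //.
  exact: (alg_geom_mult P).2.1 alg_geom.
pose M := invmx (C *m B).
pose Pi := 1%:M - B *m M *m C.
have APi : A *m Pi = 0.
  rewrite /Pi mulmxBr mulmx1 AE !mulmxA -(mulmxA B C B) -(mulmxA B (C *m B) M).
  by rewrite mulmxV // mulmx1 subrr.
have PiA : Pi *m A = 0.
  rewrite /Pi mulmxBl mul1mx AE !mulmxA -(mulmxA (B *m M) C B).
  by rewrite -(mulmxA B M (C *m B)) mulVmx // mulmx1 subrr.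
(* [1 - Pi] factors through [A], hence kills the kernel of [A]; this excludes the eigenvalue 0 at
   the end. *)
have PiE : 1%:M - Pi = B *m M *m M *m C *m A.
  rewrite /Pi subKr AE !mulmxA -(mulmxA _ C B) -(mulmxA _ M (C *m B)).
  by rewrite mulVmx // mulmx1.
have Pi2 : Pi *m Pi = Pi.
  apply/eqP; rewrite -subr_eq0 -oppr_eq0 opprB -{1}[Pi]mul1mx -mulmxBl PiE.
  by rewrite -(mulmxA _ A Pi) APi mulmx0.
exists Pi; split; [exact: APi|exact: PiA|exact: Pi2|].
move=> z /right_eigenvalueP[v APiv v0].
pose PiC := mxC Pi; pose AC := mxC A.
have E1 : PiC *m AC = 0 by rewrite /PiC /AC /mxC -map_mxM PiA map_mx0.
have E2 : PiC *m PiC = PiC by rewrite /PiC /mxC -map_mxM Pi2.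
have AvE : AC *m v = z *: v + PiC *m v.
  by rewrite -APiv /mxC map_mxB mulmxBl addrNK.
(* Applying [Pi] to the eigenvalue equation leaves two cases: z = -1, or Pi v = 0 and [v] is an
   eigenvector of [A] itself. *)
have : - (PiC *m v) = z *: (PiC *m v).
  have := congr1 (mulmx PiC) AvE.
  rewrite mulmxA E1 mul0mx mulmxDr mulmxA E2 -scalemxAr => /esym/eqP.
  by rewrite addr_eq0 => /eqP ->.
move/eqP; rewrite -scaleN1r -subr_eq0 -scalerBl scaler_eq0 => /orP[|/eqP Piv].
  by rewrite subr_eq0 => /eqP <- /=; rewrite oppr_lt0 ltr01.
move: AvE; rewrite Piv addr0 => AvE.
have /spec : eigenvalue (mxC P) (z + 1).
  by rewrite -eigenvalue_sub1; apply/right_eigenvalueP; exists v.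
case=> [|/eqP]; first by rewrite ReD /= -ltrBrDr subrr.
rewrite -subr_eq0 addrK => /eqP z0.
case/eqP: v0.
have : mxC (1%:M - Pi) *m v = v.
  by rewrite /mxC map_mxB map_mx1 mulmxBl mul1mx -/PiC Piv subr0.
move=> <-; rewrite PiE /mxC map_mxM -mulmxA -/(mxC A) -/AC AvE z0 scale0r.
by rewrite mulmx0.
Qed.

(** If C B w = 0, write B w = A t with [t] a preimage of [w] under [C]. Then A (A t) = B (C B w) =
    0, so B w = A t = 0, and w = 0 since [B] is injective. *)
Lemma unitmx_semisimple n (A : 'M[R]_n) :
  (forall v : 'cV_n, A *m (A *m v) = 0 -> A *m v = 0) ->
  row_base A *m col_base A \in unitmx.
Proof.
move: (row_base_free A) (col_base_full A) (esym (mulmx_base A)).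
move: (\rank A) (row_base A) (col_base A) => k C B /mulmxVp CV /mulVpmx BV AE A2.
rewrite -unitmx_tr -row_free_unit; apply: inj_row_free => w wCB.
have {}wCB : C *m (B *m w^T) = 0.
  by apply: trmx_inj; rewrite mulmxA !trmx_mul trmxK trmx0 -trmx_mul.
apply: trmx_inj; rewrite trmx0.
rewrite -[w^T]mul1mx -BV -mulmxA.
have Bw : B *m w^T = A *m (pinvmx C *m w^T).
  by rewrite [in RHS]AE -mulmxA (mulmxA C) CV mul1mx.
by rewrite Bw A2 ?mulmx0 // -Bw AE -mulmxA wCB mulmx0.
Qed.

End Spectrum.

(** * Real recursions *)

Section Sequences.
Context (R : realType).
Local Open Scope classical_set_scope.
Local Open Scope ring_scope.
Implicit Types a b p g v : nat -> R.

Definition unbounded_sums a := forall M, exists N, M <= \sum_(0 <= s < N) a s.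
Definition bounded_sums b := exists C, forall N, \sum_(0 <= s < N) b s <= C.

Lemma nneseries_unbounded a : (forall s, 0 <= a s) ->
  (\sum_(0 <= s <oo) (a s)%:E = +oo)%E -> unbounded_sums a.
Proof.
move=> a0 sumy M; apply: contrapT => /forallNP ltM.
suff : (\sum_(0 <= s <oo) (a s)%:E <= M%:E)%E by rewrite sumy leye_eq.
apply: lime_le; first by apply: is_cvg_nneseries => s _ _; rewrite lee_fin.
near=> N; rewrite sumEFin lee_fin leNgt; apply/negP => /ltW; exact: ltM.
Unshelve. all: by end_near. Qed.

Lemma nneseries_bounded b : (forall s, 0 <= b s) ->
  (\sum_(0 <= s <oo) (b s)%:E < +oo)%E -> bounded_sums b.
Proof.
move=> b0 sumlty; exists (fine (\sum_(0 <= s <oo) (b s)%:E)%E) => N.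
rewrite -lee_fin fineK; last first.
  by rewrite ge0_fin_numE // nneseries_ge0 // => s _ _; rewrite lee_fin.
by rewrite -sumEFin; apply: nneseries_lim_ge => s _; rewrite lee_fin.
Qed.

Lemma sum_increments_false a p (e C : R) N : 0 < e ->
  (forall s, 0 <= a s) -> unbounded_sums a ->
  (forall s, (N <= s)%N -> p s + e * a s <= p s.+1) ->
  (forall s, p s <= C) -> False.
Proof.
move=> e0 a0 ay incr pC.
have low k : p N + e * \sum_(N <= s < N + k) a s <= p (N + k)%N.
  elim: k => [|k IH]; first by rewrite addn0 big_geq // mulr0 addr0.
  rewrite addnS big_nat_recr ?leq_addr //= mulrDr addrA.
  by apply: le_trans (incr _ (leq_addr _ _)); rewrite lerD2r.
have [k le_k] := ay ((C - p N) / e + \sum_(0 <= s < N) a s + 1).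
have split_sum : \sum_(0 <= s < N + k) a s =
    \sum_(0 <= s < N) a s + \sum_(N <= s < N + k) a s.
  by rewrite -big_cat_nat ?leq_addr.
have mono_sum : \sum_(0 <= s < k) a s <= \sum_(0 <= s < N + k) a s.
  rewrite (@big_cat_nat _ _ _ k 0 (N + k)) ?leq_addl //= lerDl.
  by apply: sumr_ge0.
have gt_sum : (C - p N) / e < \sum_(N <= s < N + k) a s by lra.
move: gt_sum; rewrite ltr_pdivrMr // mulrC.
by have := low k; have := pC (N + k)%N; lra.
Qed.

(** A limit l > 0 would make [p] grow at least like l / 2 times the divergent sums of [a], although
    [p] converges; l < 0 is symmetric. *)
Lemma increments_lim0 a p g (l l' : R) : (forall s, 0 <= a s) ->
  unbounded_sums a -> (forall s, p s.+1 = p s + a s * g s) ->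
  p @ \oo --> l' -> g @ \oo --> l -> l = 0.
Proof.
wlog l0 : p g l l' / 0 <= l.
  move=> wl a0 ay pE pl' gl; have [l0|/ltW l0] := leP 0 l; first exact: wl pl' gl.
  apply: oppr_inj; rewrite oppr0.
  apply: (wl (fun s => - p s) (fun s => - g s) (- l) (- l')) => //.
  - by rewrite oppr_ge0.
  - by move=> s; rewrite pE opprD mulrN.
  - exact: cvgN.
  - exact: cvgN.
move=> a0 ay pE pl' gl; apply: contrapT => /eqP lN0.
have {}l0 : 0 < l by rewrite lt_def lN0.
have [C pC] : exists C, forall s, p s <= C.
  have /cvg_seq_bounded[M [_ /(_ (M + 1))]] : cvgn p by apply/cvg_ex; exists l'.
  rewrite ltrDl ltr01 => /(_ isT) pM; exists (M + 1) => s.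
  by apply: le_trans (pM s I); exact: ler_norm.
have : \forall s \near \oo, l / 2 < g s.
  by apply: (cvgr_gt l) => //; rewrite ltr_pdivrMr // ltr_pMr // ltr1n.
case=> N _ gN; apply: (@sum_increments_false a p (l / 2) C N) => //.
  by rewrite divr_gt0.
by move=> s Ns; rewrite pE lerD2l mulrC ler_wpM2l // ltW // gN.
Qed.

(** Subtracting the partial sums of [b] from [v] gives a nonincreasing sequence bounded below, so
    [v] converges. A positive limit would make the decrements [c * a s * v s] sum to infinity. *)
Lemma contraction_cvg0 a b v (c : R) : 0 < c -> (forall s, 0 <= a s) ->
  (forall s, 0 <= b s) -> (forall s, 0 <= v s) ->
  unbounded_sums a -> bounded_sums b ->
  (forall s, v s.+1 <= v s - c * a s * v s + b s) -> v @ \oo --> 0.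
Proof.
move=> c0 a0 b0 v0 ay [C bC] vS.
pose B N := \sum_(0 <= s < N) b s.
have B_cvg : cvgn B.
  apply: nondecreasing_is_cvgn.
    by apply/nondecreasing_seqP => s; rewrite /B big_nat_recr //= lerDl.
  by exists C => _ [s _ <-]; exact: bC.
pose w s := v s - B s.
have wS s : w s.+1 <= w s - c * a s * v s.
  by rewrite /w /B big_nat_recr //= lerBlDr (le_trans (vS s)) //; lra.
have w_ge s : - C <= w s.
  by rewrite lerNl /w opprB; apply: le_trans (bC s); rewrite lerBlDr lerDl.
have w_cvg : cvgn w.
  apply: nonincreasing_is_cvgn; last by exists (- C) => _ [s _ <-].
  apply/nonincreasing_seqP => s; apply: (le_trans (wS s)).
  by rewrite gerBl !mulr_ge0 // ltW.
have v_cvg : v @ \oo --> limn w + limn B.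
  have -> : v = w \+ B by apply/funext => s; rewrite /w /= subrK.
  exact: cvgD w_cvg B_cvg.
have l0 : 0 <= limn w + limn B.
  by rewrite -(cvg_lim _ v_cvg) //; apply: limr_ge; [apply/cvg_ex; eexists; exact: v_cvg|exact: nearW].
have [<- //|lN0] := eqVneq (limn w + limn B) 0.
exfalso; set l := limn w + limn B in l0 v_cvg lN0.
have {}l0 : 0 < l by rewrite lt_def lN0.
have : \forall s \near \oo, l / 2 < v s.
  by apply: (cvgr_gt l) => //; rewrite ltr_pdivrMr // ltr_pMr // ltr1n.
case=> N _ vN; apply: (@sum_increments_false a (fun s => - w s) (c * (l / 2)) C N) => //.
- by rewrite mulr_gt0 ?divr_gt0.
- move=> s Ns; have := wS s; rewrite -lerN2 opprB => /(le_trans _); apply.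
  rewrite [leRHS]addrC lerD2l.
  have /ltW vs : l / 2 < v s := vN s Ns.
  by rewrite [leRHS]mulrAC ler_wpM2r // ler_wpM2l // ltW.
- by move=> s; rewrite lerNl.
Qed.

Lemma gronwall b v : (forall s, 0 <= b s) -> (forall s, 0 <= v s) ->
  bounded_sums b -> (forall s, v s.+1 <= (1 + b s) * v s) ->
  exists C, forall s, v s <= C.
Proof.
move=> b0 v0 [C bC] vS.
have v_le s : v s <= expR (\sum_(0 <= k < s) b k) * v 0%N.
  elim: s => [|s IH]; first by rewrite big_geq // expR0 mul1r.
  apply: (le_trans (vS s)); rewrite big_nat_recr //= expRD mulrC.
  apply: (@le_trans _ _ (v s * expR (b s))).
    by rewrite ler_wpM2l // expR_ge1Dx.
  by rewrite mulrAC ler_wpM2r ?expR_ge0.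
exists (expR C * v 0%N) => s; apply: (le_trans (v_le s)).
by rewrite ler_wpM2r // ler_expR.
Qed.

Lemma bounded_sums_tail b : (forall s, 0 <= b s) -> bounded_sums b ->
  forall e, 0 < e -> exists N, forall s t, (N <= s)%N -> (s <= t)%N ->
    \sum_(s <= k < t) b k <= e.
Proof.
move=> b0 [C bC] e e0; pose B N := \sum_(0 <= s < N) b s.
have B_nd : nondecreasing_seq B.
  by apply/nondecreasing_seqP => s; rewrite /B big_nat_recr //= lerDl.
have B_cvg : cvgn B.
  by apply: nondecreasing_is_cvgn => //; exists C => _ [s _ <-]; exact: bC.
have : \forall s \near \oo, limn B - e < B s.
  by apply: (cvgr_gt (limn B)) => //; rewrite gtrBl.
case=> N _ BN; exists N => s t Ns st.
have /= Bs := BN _ Ns; have Bt := nondecreasing_cvgn_le B_nd B_cvg t.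
have : B t = B s + \sum_(s <= k < t) b k by rewrite -big_cat_nat.
by lra.
Qed.

Lemma cvg0_sqr p g : (forall s, p s ^+ 2 <= g s) -> g @ \oo --> 0 ->
  p @ \oo --> 0.
Proof.
move=> pg /cvgrPdist_le g0; apply/cvgrPdist_le => e e0.
have := g0 _ (exprn_gt0 2 e0); apply: filterS => s /=.
rewrite !sub0r !normrN => ge.
rewrite -(@ler_pXn2r _ 2) ?nnegrE ?normr_ge0 ?(ltW e0) // real_normK ?num_real //.
by apply: le_trans (pg s) (le_trans (ler_norm _) ge).
Qed.

Lemma cvg0_le p g (K : R) : (forall s, 0 <= p s) -> (forall s, p s <= K * g s) ->
  g @ \oo --> 0 -> p @ \oo --> 0.
Proof.
move=> p0 pg g0; apply: (@squeeze_cvgr _ _ _ _ (cst 0) (fun s => K * g s)).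
- by apply: nearW => s; rewrite p0 pg.
- exact: cvg_cst.
by rewrite -[X in _ --> X](mulr0 K); apply: cvgM g0; exact: cvg_cst.
Qed.

End Sequences.

(** * Integration against functions measurable for a sub-sigma-algebra *)

Section RealExpectation.
Context (d : measure_display) (T : measurableType d) (R : realType).
Variable Pr : probability T R.
Local Open Scope classical_set_scope.
Local Open Scope ring_scope.
Implicit Types (f g X Y : T -> R) (G : set (set T)).

Definition L1 f := Pr.-integrable setT (EFin \o f).
(** Real-valued: an infinite integral is read as 0, which is why most rules below carry
    integrability hypotheses. *)
Definition Ex f : R := \int[Pr]_w f w.

Lemma L1_measurable f : L1 f -> measurable_fun setT f.
Proof. by move=> /integrableP[/measurable_EFinP]. Qed.

Lemma L1_le f g : measurable_fun setT f -> L1 g ->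
  (forall w, `|f w| <= g w) -> L1 f.
Proof.
move=> mf ig fg; apply: le_integrable ig => //; first exact/measurable_EFinP.
by move=> w _; rewrite lee_fin (le_trans (fg w)) // ler_norm.
Qed.

Lemma L1_cst (c : R) : L1 (cst c).
Proof. exact: finite_measure_integrable_cst. Qed.

Lemma L1D f g : L1 f -> L1 g -> L1 (fun w => f w + g w).
Proof. by move=> fi gi; exact: (integrableD measurableT fi gi). Qed.

Lemma L1Z (c : R) f : L1 f -> L1 (fun w => c * f w).
Proof. by move=> fi; exact: (integrableZl measurableT c fi). Qed.

Lemma L1B f g : L1 f -> L1 g -> L1 (fun w => f w - g w).
Proof. by move=> fi gi; exact: (integrableB measurableT fi gi). Qed.

Lemma L1_norm f : L1 f -> L1 (fun w => `|f w|).
Proof. exact: integrable_abse. Qed.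

Lemma L1_sum I (r : seq I) (F : I -> T -> R) :
  (forall i, L1 (F i)) -> L1 (fun w => \sum_(i <- r) F i w).
Proof.
move=> Fi; elim: r => [|i r IH].
  by under eq_fun do rewrite big_nil; exact: L1_cst.
by under eq_fun do rewrite big_cons; exact: L1D.
Qed.

Lemma EFin_Ex f : L1 f -> ((Ex f)%:E = \int[Pr]_w (f w)%:E)%E.
Proof. by move=> fi; rewrite fineK //; exact: integrable_fin_num. Qed.

Lemma Ex_cst (c : R) : Ex (cst c) = c.
Proof. by rewrite /Ex Rintegral_cst //= probability_setT mulr1. Qed.

Lemma ExD f g : L1 f -> L1 g -> Ex (fun w => f w + g w) = Ex f + Ex g.
Proof. by move=> fi gi; exact: RintegralD. Qed.

Lemma ExB f g : L1 f -> L1 g -> Ex (fun w => f w - g w) = Ex f - Ex g.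
Proof. by move=> fi gi; exact: RintegralB. Qed.

Lemma ExZ (c : R) f : L1 f -> Ex (fun w => c * f w) = c * Ex f.
Proof. by move=> fi; exact: RintegralZl. Qed.

Lemma Ex_sum I (r : seq I) (F : I -> T -> R) : (forall i, L1 (F i)) ->
  Ex (fun w => \sum_(i <- r) F i w) = \sum_(i <- r) Ex (F i).
Proof.
move=> Fi; elim: r => [|i r IH].
  by rewrite big_nil; under eq_fun do rewrite big_nil; exact: Ex_cst.
rewrite big_cons -IH -ExD //; last exact: L1_sum.
by congr Ex; apply/funext => w; rewrite big_cons.
Qed.

Lemma Ex_le f g : L1 f -> L1 g -> (forall w, f w <= g w) -> Ex f <= Ex g.
Proof. by move=> fi gi fg; exact: le_Rintegral. Qed.

Lemma Ex_ge0 f : (forall w, 0 <= f w) -> 0 <= Ex f.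
Proof. by move=> f0; exact: Rintegral_ge0. Qed.

Lemma Ex_norm f : L1 f -> `|Ex f| <= Ex (fun w => `|f w|).
Proof. by move=> fi; exact: le_normr_Rintegral. Qed.

Lemma L1_ge0 f : measurable_fun setT f -> (forall w, 0 <= f w) ->
  (\int[Pr]_w (f w)%:E < +oo)%E -> L1 f.
Proof.
move=> mf f0 fy; apply/integrableP; split; first exact/measurable_EFinP.
by under eq_integral do rewrite /= ger0_norm //.
Qed.

(** The series counts the natural numbers below [y]; its sum of [n] terms lies between min(y, n) and
    min(n, y + 1). *)
Lemma layer_sum (y : R) : 0 <= y ->
  (y%:E <= \sum_(0 <= k <oo) ((k%:R < y)%R%:R)%:E <= (y + 1)%:E)%E.
Proof.
move=> y0.
have nonneg k : (0 <= ((k%:R < y :> R)%R%:R)%:E :> \bar R)%E by rewrite lee_fin.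
apply/andP; split.
  have [k yk] : exists k, y <= k%:R.
    by exists (Num.bound y); rewrite ltW // -[y]ger0_norm // archi_boundP.
  apply: le_trans (nneseries_lim_ge k _) => //.
  rewrite sumEFin lee_fin.
  have : Num.min y k%:R <= \sum_(0 <= j < k) (j%:R < y)%R%:R :> R.
    elim: k {yk} => [|k IH]; first by rewrite big_geq // ge_min lexx orbT.
    rewrite big_nat_recr //=; have [ky|yk] := ltP k%:R y.
      rewrite (min_idPr (ltW ky)) in IH.
      by rewrite -natr1 (le_trans _ (lerD IH (lexx _))) // ge_min lexx orbT.
    by rewrite addr0 (le_trans _ IH) // (min_idPl yk) ge_min lexx.
  by rewrite (min_idPl yk).
apply: lime_le; first by apply: is_cvg_nneseries.
apply: nearW => n; rewrite sumEFin lee_fin.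
have : \sum_(0 <= j < n) (j%:R < y)%R%:R <= Num.min n%:R (y + 1) :> R.
  elim: n => [|n IH]; first by rewrite big_geq // le_min lexx addr_ge0.
  rewrite big_nat_recr //=; have [ny|yn] := ltP n%:R y.
    rewrite (le_trans (lerD IH (lexx _))) // le_min -natr1 !lerD2r !ge_min lexx /=.
    by rewrite ltW.
  rewrite addr0 (le_trans IH) // le_min !ge_min lexx orbT andbT.
  by rewrite ler_nat leqnSn.
by move=> /le_trans; apply; rewrite ge_min lexx orbT.
Qed.

(* [X] is compared with the sum over k of the indicators of [k < X], which lies
   between [X] and [X + 1]. *)
Lemma le_integral_layer G f g X :
  (forall A, G A -> measurable A) ->
  measurable_fun setT f -> measurable_fun setT g -> measurable_fun setT X ->
  (forall w, 0 <= f w) -> (forall w, 0 <= g w) -> (forall w, 0 <= X w) ->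
  (forall t : R, G [set w | t < X w]) ->
  (forall A, G A ->
    \int[Pr]_(w in A) (f w)%:E <= \int[Pr]_(w in A) (g w)%:E)%E ->
  (\int[Pr]_w (X w * f w)%:E <= \int[Pr]_w ((X w + 1) * g w)%:E)%E.
Proof.
move=> Gm mf mg mX f0 g0 X0 GX fg.
pose A k := [set w | k%:R < X w].
have mA k : measurable (A k) by exact: Gm (GX _).
pose S (h : T -> R) := fun w => (\sum_(0 <= k <oo) ((k%:R < X w)%R%:R * h w)%:E)%E.
have ind_meas (h : T -> R) k : measurable_fun setT h ->
    measurable_fun setT (fun w => ((k%:R < X w)%R%:R * h w)%:E).
  move=> mh; apply/measurable_EFinP; apply: measurable_funM => //.
  have -> : (fun w => (k%:R < X w)%R%:R) = \1_(A k) :> (T -> R).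
    by apply/funext => w; rewrite indicE; congr (nat_of_bool _)%:R;
      apply/idP/idP; [move=> ?; apply/mem_set|move/set_mem].
  exact: measurable_indic.
have intS (h : T -> R) : measurable_fun setT h -> (forall w, 0 <= h w) ->
    (\int[Pr]_w S h w = \sum_(0 <= k <oo) \int[Pr]_(w in A k) (h w)%:E)%E.
  move=> mh h0; rewrite /S integral_nneseries //; last 2 first.
  - by move=> k; exact: ind_meas.
  - by move=> k w _; rewrite lee_fin mulr_ge0.
  apply: eq_eseriesr => k _; rewrite [RHS]integral_mkcond epatch_indic.
  apply: eq_integral => w _ /=; rewrite -EFinM mulrC indicE.
  congr (_ * (nat_of_bool _)%:R)%:E.
  by apply/idP/idP; [move=> ?; apply/mem_set|move/set_mem].
have SE (h : T -> R) w : 0 <= h w ->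
    ((X w * h w)%:E <= S h w <= ((X w + 1) * h w)%:E)%E.
  move=> h0; have /andP[l1 l2] := layer_sum (X0 w).
  have -> : S h w = ((h w)%:E * \sum_(0 <= k <oo) ((k%:R < X w)%R%:R)%:E)%E.
    rewrite -nneseriesZl //; apply: eq_eseriesr => k _.
    by rewrite -EFinM mulrC.
  by rewrite ![(_ * h w)%R]mulrC !EFinM !lee_wpmul2l ?lee_fin.
have mS (h : T -> R) : measurable_fun setT h -> (forall w, 0 <= h w) ->
    measurable_fun setT (S h).
  move=> mh h0; apply: ge0_emeasurable_sum => [k w _ _|k _].
    by rewrite lee_fin mulr_ge0.
  exact: ind_meas.
apply: (@le_trans _ _ (\int[Pr]_w S f w)%E).
  apply: ge0_le_integral => //.
  - by move=> w _; rewrite lee_fin mulr_ge0.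
  - by apply/measurable_EFinP; exact: measurable_funM.
  - exact: mS.
  - by move=> w _; have /andP[] := SE f w (f0 w).
rewrite intS //; apply: (@le_trans _ _ (\int[Pr]_w S g w)%E).
  rewrite intS //; apply: lee_nneseries => k *; first by apply: integral_ge0 => w _; rewrite lee_fin.
  exact: fg (GX _).
apply: ge0_le_integral => //.
- by move=> w _; have /andP[/(le_trans _) + _] := SE g w (g0 w); apply; rewrite lee_fin mulr_ge0.
- exact: mS.
- apply/measurable_EFinP; apply: measurable_funM => //.
  exact: measurable_funD.
- by move=> w _; have /andP[] := SE g w (g0 w).
Qed.

(** Applied to the multiples [N * X], the layer comparison gives N E[X f] <= N E[X g] + E[g];
    divided by N, the error E[g] becomes arbitrarily small. *)
Lemma le_Ex_layer G f g X :
  (forall A, G A -> measurable A) ->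
  measurable_fun setT f -> L1 g -> measurable_fun setT X ->
  (forall w, 0 <= f w) -> (forall w, 0 <= g w) -> (forall w, 0 <= X w) ->
  (forall t : R, G [set w | t < X w]) ->
  (forall A, G A ->
    \int[Pr]_(w in A) (f w)%:E <= \int[Pr]_(w in A) (g w)%:E)%E ->
  L1 (fun w => X w * g w) ->
  L1 (fun w => X w * f w) /\ Ex (fun w => X w * f w) <= Ex (fun w => X w * g w).
Proof.
move=> Gm mf ig mX f0 g0 X0 GX fg iXg.
have mg := L1_measurable ig.
have Xf : L1 (fun w => X w * f w).
  apply: L1_ge0; first exact: measurable_funM.
    by move=> w; rewrite mulr_ge0.
  apply: le_lt_trans (le_integral_layer Gm mf mg mX f0 g0 X0 GX fg) _.
  apply: integrable_lty => //.
  have := L1D iXg ig; apply: eq_integrable => // w _ /=.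
  by rewrite mulrDl mul1r.
split=> //; apply/ler_addgt0Pl => e e0.
have [N N0 Ne] : exists2 N : R, 0 < N & Ex g <= N * e.
  exists (Ex g / e + 1); first by rewrite ltr_wpDl ?divr_ge0 ?Ex_ge0 // ltW.
  by rewrite mulrDl divfK ?gt_eqF // mul1r lerDl ltW.
have NX w : 0 <= N * X w by rewrite mulr_ge0 // ltW.
have GNX t : G [set w | t < N * X w].
  have := GX (t / N); congr (G _); apply/seteqP; split=> w /=; rewrite ltr_pdivrMr // mulrC //.
have := le_integral_layer Gm mf mg (measurable_funM (measurable_cst N) mX) f0 g0 NX GNX fg.
have E1 : (\int[Pr]_w ((N * X w) * f w)%:E = (N * Ex (fun w => X w * f w))%:E)%E.
  by rewrite -ExZ // EFin_Ex; [under eq_integral do rewrite -mulrA|exact: L1Z].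
have E2 : (\int[Pr]_w ((N * X w + 1) * g w)%:E =
    (N * Ex (fun w => X w * g w) + Ex g)%:E)%E.
  rewrite -ExZ // -ExD // ?EFin_Ex; [|exact: L1D (L1Z _ _) _|exact: L1Z].
  by under eq_integral do rewrite mulrDl mul1r -mulrA.
rewrite E1 E2 lee_fin => le_N.
rewrite -(ler_pM2l N0) mulrDr; apply: (le_trans le_N).
by rewrite addrC lerD2r.
Qed.

Let posp f := fun w => Num.max (f w) 0.
Let negp f := fun w => Num.max (- f w) 0.

Let pospB f w : posp f w - negp f w = f w.
Proof.
rewrite /posp /negp; have [f0|f0] := ltP (f w) 0.
  by rewrite (max_idPl _) ?oppr_ge0 ?ltW // opprK add0r.
by rewrite (max_idPr _) ?oppr_le0 // subr0.
Qed.

Let posp_ge0 f w : 0 <= posp f w. Proof. by rewrite le_max lexx orbT. Qed.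
Let negp_ge0 f w : 0 <= negp f w. Proof. by rewrite le_max lexx orbT. Qed.

Let posp_le f w : posp f w <= `|f w|.
Proof. by rewrite ge_max ler_norm normr_ge0. Qed.

Let negp_le f w : negp f w <= `|f w|.
Proof. by rewrite ge_max lerNl lerNnormlW // normr_ge0. Qed.

Let measurable_posp f : measurable_fun setT f -> measurable_fun setT (posp f).
Proof. by move=> mf; exact: measurable_maxr. Qed.

Let measurable_negp f : measurable_fun setT f -> measurable_fun setT (negp f).
Proof. by move=> mf; apply: measurable_maxr => //; exact: measurable_funN. Qed.

(* Both parts of [Y] have the same integral over every set of [G]. *)
Let Ex_mul_centered_ge0 G X Y :
  (forall A, G A -> measurable A) ->
  L1 Y -> (forall A, G A -> \int[Pr]_(w in A) (Y w)%:E = 0)%E ->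
  measurable_fun setT X -> (forall w, 0 <= X w) ->
  (forall t : R, G [set w | t < X w]) ->
  L1 (fun w => X w * Y w) -> Ex (fun w => X w * Y w) = 0.
Proof.
move=> Gm iY Y0 mX X0 GX iXY.
have mY := L1_measurable iY; have iYn := L1_norm iY; have iXYn := L1_norm iXY.
have ip : L1 (posp Y).
  by apply: (L1_le (measurable_posp mY) iYn) => w; rewrite ger0_norm.
have iN : L1 (negp Y).
  by apply: (L1_le (measurable_negp mY) iYn) => w; rewrite ger0_norm.
have iXp : L1 (fun w => X w * posp Y w).
  apply: (L1_le _ iXYn) => [|w]; first exact: measurable_funM (measurable_posp mY).
  by rewrite !normrM ler_wpM2l // ger0_norm.
have iXN : L1 (fun w => X w * negp Y w).
  apply: (L1_le _ iXYn) => [|w]; first exact: measurable_funM (measurable_negp mY).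
  by rewrite !normrM ler_wpM2l // ger0_norm.
have eqA A : G A ->
    (\int[Pr]_(w in A) (posp Y w)%:E = \int[Pr]_(w in A) (negp Y w)%:E)%E.
  move=> GA; have mA := Gm _ GA.
  have ipA : Pr.-integrable A (EFin \o posp Y) by exact: integrableS ip.
  have iNA : Pr.-integrable A (EFin \o negp Y) by exact: integrableS iN.
  have := Y0 A GA; under eq_integral do rewrite -(pospB Y) EFinB.
  rewrite integralB // => /eqP.
  rewrite sube_eq ?add0e; last 2 first.
  - exact: integrable_fin_num ipA.
  - by rewrite fin_num_adde_defl //; exact: integrable_fin_num iNA.
  by move=> /eqP.
have le1 : Ex (fun w => X w * posp Y w) <= Ex (fun w => X w * negp Y w).
  apply: (le_Ex_layer Gm _ iN mX _ _ X0 GX _ iXN).2 => // [|A GA].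
    exact: measurable_posp.
  by rewrite eqA.
have le2 : Ex (fun w => X w * negp Y w) <= Ex (fun w => X w * posp Y w).
  apply: (le_Ex_layer Gm _ ip mX _ _ X0 GX _ iXp).2 => // [|A GA].
    exact: measurable_negp.
  by rewrite eqA.
transitivity (Ex (fun w => X w * posp Y w - X w * negp Y w)).
  by congr Ex; apply/funext => w; rewrite -mulrBr pospB.
by rewrite ExB //; apply/eqP; rewrite subr_eq0 eq_le le1 le2.
Qed.

Lemma Ex_mul_centered G X Y :
  (forall A, G A -> measurable A) -> G setT ->
  L1 Y -> (forall A, G A -> \int[Pr]_(w in A) (Y w)%:E = 0)%E ->
  measurable_fun setT X ->
  (forall t : R, G [set w | t < X w]) -> (forall t : R, G [set w | X w < t]) ->
  L1 (fun w => X w * Y w) -> Ex (fun w => X w * Y w) = 0.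
Proof.
move=> Gm GT iY Y0 mX GX GX' iXY; have mY := L1_measurable iY.
have iXYn := L1_norm iXY.
have iXp : L1 (fun w => posp X w * Y w).
  apply: (L1_le _ iXYn) => [|w]; first exact: measurable_funM (measurable_posp mX) _.
  by rewrite !normrM ler_wpM2r // ger0_norm.
have iXN : L1 (fun w => negp X w * Y w).
  apply: (L1_le _ iXYn) => [|w]; first exact: measurable_funM (measurable_negp mX) _.
  by rewrite !normrM ler_wpM2r // ger0_norm.
(* For t < 0 the level set {t < Z} of a nonnegative function is the whole space; this is where
   [G setT] enters. *)
have setT_lt (Z : T -> R) (t : R) : (forall w, 0 <= Z w) -> t < 0 ->
    [set w | t < Z w] = setT.
  by move=> Z0 t0; apply/seteqP; split=> // w _ /=; exact: lt_le_trans (Z0 w).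
have p0 : Ex (fun w => posp X w * Y w) = 0.
  apply: (Ex_mul_centered_ge0 Gm) => // [|t]; first exact: measurable_posp.
  have [t0|t0] := ltP t 0; first by rewrite setT_lt.
  have := GX t; congr G; apply/seteqP; split=> w /=; by rewrite lt_max [t < 0]ltNge t0 orbF.
have n0 : Ex (fun w => negp X w * Y w) = 0.
  apply: (Ex_mul_centered_ge0 Gm) => // [|t]; first exact: measurable_negp.
  have [t0|t0] := ltP t 0; first by rewrite setT_lt.
  have := GX' (- t); congr G; apply/seteqP; split=> w /=;
    by rewrite lt_max [t < 0]ltNge t0 orbF ltrNr.
transitivity (Ex (fun w => posp X w * Y w - negp X w * Y w)).
  by congr Ex; apply/funext => w; rewrite -mulrBl pospB.
by rewrite ExB // p0 n0 subr0.
Qed.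

End RealExpectation.

(** * Square integrable random vectors *)

Section SquareIntegrable.
Context (d : measure_display) (T : measurableType d) (R : realType).
Variable Pr : probability T R.
Local Open Scope classical_set_scope.
Local Open Scope ring_scope.

Definition vmeas n (X : T -> 'cV[R]_n) :=
  forall i, measurable_fun setT (fun w => X w i 0).
Definition vL2 n (X : T -> 'cV[R]_n) := vmeas X /\ L1 Pr (fun w => nsq (X w)).

Lemma measurable_dotv n (X Y : T -> 'cV[R]_n) : vmeas X -> vmeas Y ->
  measurable_fun setT (fun w => dotv (X w) (Y w)).
Proof. by move=> mX mY; apply: measurable_sum => i; exact: measurable_funM. Qed.

Lemma measurable_nsq n (X : T -> 'cV[R]_n) : vmeas X ->
  measurable_fun setT (fun w => nsq (X w)).
Proof. by move=> mX; apply: measurable_sum => i; exact: measurable_funX. Qed.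

Lemma vmeasD n (X Y : T -> 'cV[R]_n) : vmeas X -> vmeas Y ->
  vmeas (fun w => X w + Y w).
Proof.
move=> mX mY i; under eq_fun do rewrite mxE; exact: measurable_funD.
Qed.

Lemma vmeasZ n (c : R) (X : T -> 'cV[R]_n) : vmeas X ->
  vmeas (fun w => c *: X w).
Proof.
move=> mX i; under eq_fun do rewrite mxE.
by apply: measurable_funM => //; exact: measurable_cst.
Qed.

Lemma vmeas_mulmx m n (A : T -> 'M[R]_(m, n)) (X : T -> 'cV[R]_n) :
  (forall i j, measurable_fun setT (fun w => A w i j)) -> vmeas X ->
  vmeas (fun w => A w *m X w).
Proof.
move=> mA mX i; under eq_fun do rewrite mxE.
by apply: measurable_sum => j; exact: measurable_funM.
Qed.

Lemma vmeas_mulmx_cst m n (A : 'M[R]_(m, n)) (X : T -> 'cV[R]_n) :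
  vmeas X -> vmeas (fun w => A *m X w).
Proof. by apply: vmeas_mulmx => i j; exact: measurable_cst. Qed.

Lemma vL2_mulmx m n (A : 'M[R]_(m, n)) (X : T -> 'cV[R]_n) :
  vL2 X -> vL2 (fun w => A *m X w).
Proof.
move=> [mX iX]; split; first exact: vmeas_mulmx_cst.
have [K K0 leK] := nsq_mulmx A.
apply: L1_le (L1Z K iX) _; first exact/measurable_nsq/vmeas_mulmx_cst.
by move=> w; rewrite ger0_norm ?nsq_ge0.
Qed.

Lemma vL2D n (X Y : T -> 'cV[R]_n) : vL2 X -> vL2 Y -> vL2 (fun w => X w + Y w).
Proof.
move=> [mX iX] [mY iY]; split; first exact: vmeasD.
apply: L1_le (L1D (L1Z 2 iX) (L1Z 2 iY)) _; first exact/measurable_nsq/vmeasD.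
by move=> w; rewrite ger0_norm ?nsq_ge0 // nsqD_le.
Qed.

Lemma vL2Z n (c : R) (X : T -> 'cV[R]_n) : vL2 X -> vL2 (fun w => c *: X w).
Proof.
move=> X2; have := vL2_mulmx c%:M X2.
by under eq_fun do rewrite mul_scalar_mx.
Qed.

Lemma vL2B n (X Y : T -> 'cV[R]_n) : vL2 X -> vL2 Y -> vL2 (fun w => X w - Y w).
Proof.
move=> X2 Y2; have := vL2D X2 (vL2Z (-1) Y2).
by under eq_fun do rewrite scaleN1r.
Qed.

Lemma vL2_cst n (v : 'cV[R]_n) : vL2 (cst v).
Proof. by split=> [i|]; [exact: measurable_cst|exact: (L1_cst Pr (nsq v))]. Qed.

Lemma L1_dotv n (X Y : T -> 'cV[R]_n) : vL2 X -> vL2 Y ->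
  L1 Pr (fun w => dotv (X w) (Y w)).
Proof.
move=> [mX iX] [mY iY]; apply: L1_le (L1D iX iY) _; first exact: measurable_dotv.
move=> w; have := dotv_le (X w) (Y w).
have := dotv_le (X w) ((-1) *: Y w).
have -> : nsq ((-1) *: Y w) = nsq (Y w).
  by apply: eq_bigr => i _; rewrite mxE mulN1r sqrrN.
have -> : dotv (X w) ((-1) *: Y w) = - dotv (X w) (Y w).
  by rewrite /dotv -sumrN; apply: eq_bigr => i _; rewrite mxE mulN1r mulrN.
have := nsq_ge0 (X w); have := nsq_ge0 (Y w).
by rewrite ler_norml => *; apply/andP; split; lra.
Qed.

Lemma vL2_coord n (X : T -> 'cV[R]_n) i : vL2 X ->
  L1 Pr (fun w => X w i 0 ^+ 2).
Proof.
move=> [mX iX]; apply: L1_le iX _; first exact: measurable_funX.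
by move=> w; rewrite ger0_norm ?sqr_ge0 // coord_sqr_le.
Qed.

Lemma normM_le (r t : R) : `|r * t| <= r ^+ 2 + t ^+ 2.
Proof.
rewrite normrM -(real_normK (num_real r)) -(real_normK (num_real t)).
have := normr_ge0 r; have := normr_ge0 t; have := sqr_ge0 (`|r| - `|t|).
by nra.
Qed.

Lemma L1_mul (X Y : T -> R) : measurable_fun setT X -> measurable_fun setT Y ->
  L1 Pr (fun w => X w ^+ 2) -> L1 Pr (fun w => Y w ^+ 2) ->
  L1 Pr (fun w => X w * Y w).
Proof.
move=> mX mY iX iY; apply: L1_le (L1D iX iY) _; first exact: measurable_funM.
by move=> w; exact: normM_le.
Qed.

Lemma L1_sqr (X : T -> R) : measurable_fun setT X ->
  L1 Pr (fun w => X w ^+ 2) -> L1 Pr X.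
Proof.
move=> mX iX; apply: L1_le (L1D iX (L1_cst Pr 1)) _ => // w.
by have := normM_le (X w) 1; rewrite mulr1 expr1n.
Qed.

(** The variance of [|X|] is nonnegative. *)
Lemma Ex_norm_sqr (X : T -> R) : measurable_fun setT X ->
  L1 Pr (fun w => X w ^+ 2) ->
  Ex Pr (fun w => `|X w|) ^+ 2 <= Ex Pr (fun w => X w ^+ 2).
Proof.
move=> mX iX; have iX1 := L1_norm (L1_sqr mX iX).
set m := Ex Pr (fun w => `|X w|).
have : 0 <= Ex Pr (fun w => (`|X w| - m) ^+ 2) by apply: Ex_ge0 => w; exact: sqr_ge0.
have -> : (fun w => (`|X w| - m) ^+ 2) =
    (fun w => X w ^+ 2 + ((- 2 * m) * `|X w| + m ^+ 2)).
  by apply/funext => w; rewrite sqrrB real_normK ?num_real //; ring.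
rewrite ExD //; last by apply: L1D; [exact: L1Z|exact: L1_cst].
rewrite ExD //; [|exact: L1Z|exact: L1_cst].
by rewrite ExZ // -/m (Ex_cst Pr) => h; nra.
Qed.

End SquareIntegrable.

(** * Measurability for a generated sigma-algebra *)

Section SubSigmaAlgebra.
Context (d : measure_display) (T : measurableType d) (R : realType).
Local Open Scope classical_set_scope.
Local Open Scope ring_scope.

(** Encoded as measurability on the space [g_sigma_algebraType H], so that the closure lemmas for
    sums and products of measurable functions apply directly. *)
Definition smeas (H : set (set T)) (X : T -> R) :=
  measurable_fun (setT : set (g_sigma_algebraType H)) X.

Lemma smeas_preimage H X B : smeas H X -> measurable B -> <<s H >> (X @^-1` B).
Proof. by move=> sX mB; have := sX measurableT _ mB; rewrite setTI. Qed.

Lemma smeas_gt H X (t : R) : smeas H X -> <<s H >> [set w | t < X w].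
Proof.
move=> sX; have := smeas_preimage sX (measurable_itv `]t, +oo[%R).
by congr (<<s H >> _); apply/seteqP; split=> w /=; rewrite in_itv /= andbT.
Qed.

Lemma smeas_lt H X (t : R) : smeas H X -> <<s H >> [set w | X w < t].
Proof.
move=> sX; have := smeas_preimage sX (measurable_itv `]-oo, t[%R).
by congr (<<s H >> _); apply/seteqP; split=> w /=; rewrite in_itv.
Qed.

Lemma sigma_sub_measurable (H : set (set T)) :
  H `<=` measurable -> forall A, <<s H >> A -> measurable A.
Proof.
move=> Hm A; apply: smallest_sub => //; exact: sigma_algebra_measurable.
Qed.

End SubSigmaAlgebra.

(** * Moments of the state and of the noise *)

Section Process.
Context (d : measure_display) (T : measurableType d) (R : realType).
Variable Pr : probability T R.
Context (n : nat) (a : nat -> R).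
Context (Pm : nat -> T -> 'M[R]_n) (u x : nat -> T -> 'cV[R]_n).
Context (x0 : 'cV[R]_n) (P : 'M[R]_n).
Hypothesis traj : is_trajectory a Pm u x0 x.
Hypothesis hA1 : A1 Pr x Pm u P 0.
Local Open Scope classical_set_scope.
Local Open Scope ring_scope.

Let xS s w :
  x s.+1 w = (1 - a s) *: x s w + a s *: (Pm s w *m x s w + u s w).
Proof. exact: traj.2. Qed.

Let x_0 w : x 0%N w = x0. Proof. exact: traj.1. Qed.

Definition noise s w : 'cV[R]_n := (Pm s w - P) *m x s w + u s w.

Lemma state_step s w :
  x s.+1 w = x s w + a s *: ((P - 1%:M) *m x s w) + a s *: noise s w.
Proof.
rewrite xS /noise !mulmxBl mul1mx.
move: (x s w) (u s w) => y v; move: (Pm s w *m y) (P *m y) => b c.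
by apply/matrixP => i j; rewrite !mxE; ring.
Qed.

Let measurable_Pm s i j : measurable_fun setT (fun w => Pm s w i j).
Proof. by have [/(_ s i j)[/L1_measurable]] := hA1. Qed.

Let vmeas_u s : vmeas (u s).
Proof. by move=> i; have [_ /(_ s i)[/L1_measurable]] := hA1. Qed.

Lemma vmeas_state s : vmeas (x s).
Proof.
elim: s => [|s IH] i.
  by under eq_fun do rewrite x_0; exact: measurable_cst.
under eq_fun do rewrite xS; move: i.
apply: vmeasD; first exact: vmeasZ.
by apply: vmeasZ; apply: vmeasD => //; exact: vmeas_mulmx.
Qed.

(** The generators of [sigma_upto x s], in the form that [smeas] takes. *)
Definition state_events s := \bigcup_(k in `I_s.+1) sigma_at x k.

Let sub_sigma_at s i B : measurable B ->
  sigma_at x s ((fun w => x s w i 0) @^-1` B).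
Proof.
move=> mB; apply: sub_sigma_algebra; rewrite -bigcup_seq; exists i => /=.
  exact: mem_index_enum.
by exists B => //; rewrite setTI.
Qed.

Lemma smeas_coord s k i : (k <= s)%N ->
  smeas (state_events s) (fun w => x k w i 0).
Proof.
move=> ks _ B mB; rewrite setTI; apply: sub_sigma_algebra.
by exists k; [rewrite /= ltnS|exact: sub_sigma_at].
Qed.

Lemma sigma_at_measurable s A : sigma_at x s A -> measurable A.
Proof.
apply: sigma_sub_measurable => B; rewrite -bigcup_seq => -[i _ [C mC <-]].
exact: vmeas_state.
Qed.

Lemma sigma_upto_measurable s A : sigma_upto x s A -> measurable A.
Proof.
by apply: sigma_sub_measurable => B [k _]; exact: sigma_at_measurable.
Qed.

(* A bound on E[Y | x(s)] may be integrated against any nonnegative function of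
   x(s). *)
Let cond_bound s (Y Z : T -> R) (C : R) (X : T -> R) :
  is_cond_exp Pr (sigma_at x s) Y Z -> {ae Pr, forall w, Z w <= C} ->
  (forall w, 0 <= Y w) -> 0 <= C -> measurable_fun setT X ->
  (forall w, 0 <= X w) -> (forall t : R, sigma_at x s [set w | t < X w]) ->
  L1 Pr X ->
  L1 Pr (fun w => X w * Y w) /\ Ex Pr (fun w => X w * Y w) <= C * Ex Pr X.
Proof.
move=> [iY iZ _ YZ] ZC Y0 C0 mX X0 GX iX.
have XCE : (fun w => X w * C) = (fun w => C * X w).
  by apply/funext => w; rewrite mulrC.
rewrite -ExZ // -XCE.
apply: (@le_Ex_layer _ _ _ Pr (sigma_at x s) Y (cst C)) => //.
- exact: sigma_at_measurable.
- exact: L1_measurable iY.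
- exact: L1_cst.
- move=> A GA; rewrite YZ //; have mA := sigma_at_measurable GA.
  have mZ : measurable_fun A Z.
    exact: measurable_funS (L1_measurable iZ).
  (* [Z] exceeds [C] at most on a null set; truncating it makes the bound hold everywhere. *)
  have -> : (\int[Pr]_(w in A) (Z w)%:E =
      \int[Pr]_(w in A) (Num.min (Z w) C)%:E)%E.
    apply: ae_eq_integral => //.
    + exact/measurable_EFinP.
    + by apply/measurable_EFinP; apply: measurable_minr.
    + by apply: filterS ZC => w ZwC _; rewrite (min_idPl ZwC).
  apply: le_integral => //.
  + apply: (@integrableS _ _ _ _ setT) => //.
    apply: (@L1_le _ _ _ Pr _ (fun w => `|Z w| + C)).
    * by apply: measurable_minr => //; exact: L1_measurable iZ.
    * by apply: L1D; [exact: L1_norm|exact: L1_cst].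
    * move=> w; rewrite /Num.min; case: ifP => _; first by rewrite lerDl.
      by rewrite ger0_norm // lerDr.
  + by apply: (@integrableS _ _ _ _ setT) => //; exact: (L1_cst Pr C).
  + by move=> w _; rewrite lee_fin ge_min lexx orbT.
by rewrite XCE; exact: L1Z.
Qed.

Let nsq_state_gt s (t : R) : sigma_at x s [set w | t < nsq (x s w)].
Proof.
apply: smeas_gt; apply: measurable_sum => i; apply: measurable_funX.
by move=> _ B mB; rewrite setTI; exact: sub_sigma_at.
Qed.

(** The bound involving [Pm s] presupposes a square integrable x(s): it is the inductive step by
    which the square integrability of all states is obtained. *)
Let moment_bound : exists2 C : R, 0 <= C & forall s,
  [/\ L1 Pr (fun w => norm2 (u s w) ^+ 2),
      Ex Pr (fun w => norm2 (u s w) ^+ 2) <= C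
    & L1 Pr (fun w => nsq (x s w)) ->
      L1 Pr (fun w => nsq (x s w) * mxnorm2 (Pm s w) ^+ 2) /\
      Ex Pr (fun w => nsq (x s w) * mxnorm2 (Pm s w) ^+ 2) <=
      C * Ex Pr (fun w => nsq (x s w))].
Proof.
have [_ _ [C CA1]] := hA1; exists (Num.max C 0); first by rewrite le_max lexx orbT.
move=> s; have [[Z ZP ZC] [W WP WC]] := CA1 s.
have C0 : 0 <= Num.max C 0 by rewrite le_max lexx orbT.
have leC (f : T -> R) : {ae Pr, forall w, f w <= C} ->
    {ae Pr, forall w, f w <= Num.max C 0}.
  by apply: filterS => w fC; rewrite le_max fC.
(* The constant weight 1 turns the conditional bound into an unconditional one. *)
have [iU leU] : L1 Pr (fun w => 1 * norm2 (u s w) ^+ 2) /\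
    Ex Pr (fun w => 1 * norm2 (u s w) ^+ 2) <= Num.max C 0 * Ex Pr (cst 1).
  apply: (cond_bound WP (leC _ WC)) => //.
  - by move=> w; rewrite sqr_ge0.
  - move=> t; have [t1|t1] := ltP t 1.
      rewrite (_ : [set _ | _] = setT); last by apply/seteqP; split.
      by rewrite -setC0 -setTD; apply: sigma_algebraCD; exact: sigma_algebra0.
    rewrite (_ : [set _ | _] = set0); first exact: sigma_algebra0.
    by apply/seteqP; split=> w //=; rewrite ltNge t1.
  - exact: L1_cst.
have E1 : (fun w => 1 * norm2 (u s w) ^+ 2) = (fun w => norm2 (u s w) ^+ 2).
  by apply/funext => w; rewrite mul1r.
rewrite E1 (Ex_cst Pr) mulr1 in leU; rewrite E1 in iU.
split=> // iX; apply: (cond_bound ZP (leC _ ZC)) => //.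
- by move=> w; rewrite sqr_ge0.
- exact/measurable_nsq/vmeas_state.
- by move=> w; exact: nsq_ge0.
Qed.

Let nsq_noise_le s w : nsq (noise s w) <=
  4 * (nsq (x s w) * mxnorm2 (Pm s w) ^+ 2) + 4 * mxnorm2 P ^+ 2 * nsq (x s w)
  + 2 * norm2 (u s w) ^+ 2.
Proof.
apply: (le_trans (nsqD_le _ _)); rewrite norm2_sqr lerD2r.
have := nsqD_le (Pm s w *m x s w) (- (P *m x s w)).
rewrite -mulNmx -mulmxDl mulNmx.
have -> : nsq (- (P *m x s w)) = nsq (P *m x s w).
  by apply: eq_bigr => i _; rewrite mxE sqrrN.
have := nsq_mulmx_norm (Pm s w) (x s w).
by have := nsq_mulmx_norm P (x s w); lra.
Qed.

Let vmeas_noise s : vmeas (noise s).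
Proof.
apply: vmeasD => //; apply: vmeas_mulmx; last exact: vmeas_state.
move=> i j; under eq_fun do rewrite !mxE.
exact: measurable_funB.
Qed.

Let noise_L1 s : L1 Pr (fun w => nsq (x s w)) ->
  L1 Pr (fun w => 4 * (nsq (x s w) * mxnorm2 (Pm s w) ^+ 2) +
                4 * mxnorm2 P ^+ 2 * nsq (x s w) + 2 * norm2 (u s w) ^+ 2).
Proof.
have [C _ /(_ s)[iU _ iPx]] := moment_bound.
move=> iX; have [iPX _] := iPx iX.
by apply: L1D; [apply: L1D|]; exact: L1Z.
Qed.

Let vL2_noise_of s : vL2 Pr (x s) -> vL2 Pr (noise s).
Proof.
move=> [_ iX]; split; first exact: vmeas_noise.
apply: L1_le (noise_L1 iX) _; first exact/measurable_nsq/vmeas_noise.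
by move=> w; rewrite ger0_norm ?nsq_ge0.
Qed.

Lemma vL2_state s : vL2 Pr (x s).
Proof.
elim: s => [|s IH]; first by rewrite (_ : x 0%N = cst x0); [exact: vL2_cst|exact/funext].
rewrite (_ : x s.+1 = (fun w => x s w + a s *: ((P - 1%:M) *m x s w) + a s *: noise s w)).
  apply: vL2D; last exact/vL2Z/vL2_noise_of.
  by apply: vL2D => //; apply: vL2Z; exact: vL2_mulmx.
by apply/funext => w; exact: state_step.
Qed.

Lemma vL2_noise s : vL2 Pr (noise s). Proof. exact/vL2_noise_of/vL2_state. Qed.

Lemma noise_bound : exists2 K : R, 0 <= K & forall s,
  Ex Pr (fun w => nsq (noise s w)) <= K * (1 + Ex Pr (fun w => nsq (x s w))).
Proof.
have [C C0 CP] := moment_bound.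
exists (4 * C + 4 * mxnorm2 P ^+ 2 + 2 * C) => [|s].
  by have := sqr_ge0 (mxnorm2 P); lra.
have [_ iX] := vL2_state s; have [iU leU /(_ iX)[iPX lePX]] := CP s.
have [_ iN] := vL2_noise s.
apply: le_trans (Ex_le iN (noise_L1 iX) (nsq_noise_le s)) _.
rewrite ExD; [|by apply: L1D; exact: L1Z|exact: L1Z].
rewrite ExD; [|exact: L1Z|exact: L1Z].
rewrite !ExZ //.
have := Ex_ge0 Pr (fun w => nsq_ge0 (x s w)).
have := sqr_ge0 (mxnorm2 P).
set e := Ex Pr _ in lePX *; set v := mxnorm2 P ^+ 2 => v0 e0.
by nra.
Qed.

(** In the expanded noise coordinate each factor x_k(s) joins [X] to form a weight measurable for
    the past, against which the centred P_ik(s) - P_ik integrates to 0. The weight X x_k(s) may fail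
    to be square integrable, so integrability is established for the full product. *)
Lemma Ex_coord_noise s (X : T -> R) i :
  smeas (state_events s) X -> measurable_fun setT X ->
  L1 Pr (fun w => X w ^+ 2) -> Ex Pr (fun w => X w * noise s w i 0) = 0.
Proof.
move=> sX mX iX2.
have [condP condu _] := hA1.
have GT : sigma_upto x s setT.
  by rewrite -setC0 -setTD; apply: sigma_algebraCD; exact: sigma_algebra0.
have centered Y Z (c : R) : is_cond_exp Pr (sigma_upto x s) Y (cst c) ->
    smeas (state_events s) Z -> measurable_fun setT Z ->
    L1 Pr (fun w => Z w * (Y w - c)) -> Ex Pr (fun w => Z w * (Y w - c)) = 0.
  move=> [iY ic _ Yc] sZ mZ iZY.
  apply: (@Ex_mul_centered _ _ _ Pr (sigma_upto x s)) => //.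
  - exact: sigma_upto_measurable.
  - exact: L1B iY (L1_cst Pr c).
  - move=> A GA; have mA := sigma_upto_measurable GA.
    under eq_integral do rewrite EFinB.
    have iYA : Pr.-integrable A (EFin \o Y) by exact: integrableS iY.
    have icA : Pr.-integrable A (EFin \o cst c) by exact: integrableS ic.
    rewrite integralB // Yc // subee //.
    exact: integrable_fin_num icA.
  - by move=> t; exact: smeas_gt.
  - by move=> t; exact: smeas_lt.
have [_ iX] := vL2_state s.
have [C _ /(_ s)[iU _ /(_ iX)[iPX _]]] := moment_bound.
(* For integrability the factors are grouped differently: [Y k] is square integrable by the moment
   bound, hence [X * Y k] is integrable. *)
pose Y k w := (Pm s w i k - P i k) * x s w k 0.
have mY k : measurable_fun setT (Y k).
  apply: measurable_funM; last exact: vmeas_state.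
  by apply: measurable_funB => //; exact: measurable_cst.
have iY2 k : L1 Pr (fun w => Y k w ^+ 2).
  apply: (L1_le _ (L1D (L1Z 2 iPX) (L1Z (2 * mxnorm2 P ^+ 2) iX))).
    exact: measurable_funX.
  move=> w; rewrite ger0_norm ?sqr_ge0 // /Y exprMn.
  have le1 := coord_le_mxnorm2 (Pm s w) i k.
  have le2 := coord_le_mxnorm2 P i k.
  have le3 := coord_sqr_le (x s w) k.
  have -> : 2 * (nsq (x s w) * mxnorm2 (Pm s w) ^+ 2) +
      2 * mxnorm2 P ^+ 2 * nsq (x s w) =
    (2 * mxnorm2 (Pm s w) ^+ 2 + 2 * mxnorm2 P ^+ 2) * nsq (x s w) by ring.
  apply: ler_pM; rewrite ?sqr_ge0 //.
  have := sqr_ge0 (Pm s w i k + P i k); rewrite sqrrD sqrrB.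
  by lra.
have iu2 : L1 Pr (fun w => u s w i 0 ^+ 2).
  apply: (L1_le _ iU); first exact: measurable_funX (vmeas_u _ _).
  by move=> w; rewrite ger0_norm ?sqr_ge0 // norm2_sqr coord_sqr_le.
have iXY k : L1 Pr (fun w => X w * Y k w) := L1_mul mX (mY k) iX2 (iY2 k).
have iXu : L1 Pr (fun w => X w * u s w i 0) :=
  L1_mul mX (@vmeas_u s i) iX2 iu2.
have -> : (fun w => X w * noise s w i 0) =
    (fun w => \sum_k X w * Y k w + X w * u s w i 0).
  apply/funext => w; rewrite /noise mxE mulrDr mxE mulr_sumr; congr (_ + _).
  by apply: eq_bigr => k _; rewrite !mxE.
rewrite ExD //; last exact: L1_sum.
rewrite Ex_sum // big1 ?add0r => [|k _].
  have E : (fun w => X w * u s w i 0) = (fun w => X w * (u s w i 0 - (0 : 'cV[R]_n) i 0)).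
    by apply/funext => w; rewrite mxE subr0.
  by rewrite E in iXu *; exact: centered (condu s i) sX mX iXu.
have E : (fun w => X w * Y k w) =
    (fun w => (X w * x s w k 0) * (Pm s w i k - P i k)).
  by apply/funext => w; rewrite /Y mulrAC mulrA.
have iXYk := iXY k; rewrite E in iXYk *.
apply: centered (condP s i k) _ _ iXYk.
  by apply: measurable_funM => //; exact: smeas_coord.
by apply: measurable_funM => //; exact: vmeas_state.
Qed.

Lemma Ex_dotv_noise s (Y : T -> 'cV[R]_n) :
  (forall i, smeas (state_events s) (fun w => Y w i 0)) -> vL2 Pr Y ->
  Ex Pr (fun w => dotv (Y w) (noise s w)) = 0.
Proof.
move=> sY Y2; have [mY _] := Y2; have N2 := vL2_noise s.
rewrite /dotv Ex_sum => [|i]; last first.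
  by apply: L1_mul => //; [exact: N2.1|exact: vL2_coord|exact: vL2_coord].
by rewrite big1 // => i _; apply: Ex_coord_noise => //; exact: vL2_coord.
Qed.

Lemma Ex_noise s i : Ex Pr (fun w => noise s w i 0) = 0.
Proof.
have <- : Ex Pr (fun w => cst 1 w * noise s w i 0) = 0.
  apply: Ex_coord_noise; [exact: measurable_cst|exact: measurable_cst|].
  exact: (L1_cst Pr (1 ^+ 2)).
by congr Ex; apply/funext => w; rewrite mul1r.
Qed.

End Process.

(** * Completeness of L2 *)

Section Completeness.
Context (d : measure_display) (T : measurableType d) (R : realType).
Variable Pr : probability T R.
Local Open Scope classical_set_scope.
Local Open Scope ring_scope.

(* Riesz-Fischer: a subsequence with summable increments converges almost
   surely, and Fatou's lemma identifies its limit as the limit in L2. *)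
Lemma L2_complete (f : nat -> T -> R) :
  (forall s, measurable_fun setT (f s)) ->
  (forall s, L1 Pr (fun w => f s w ^+ 2)) ->
  (forall e, 0 < e -> exists N, forall s t, (N <= s)%N -> (N <= t)%N ->
    Ex Pr (fun w => (f s w - f t w) ^+ 2) <= e) ->
  exists y : T -> R, [/\ measurable_fun setT y, L1 Pr (fun w => y w ^+ 2)
    & Ex Pr (fun w => (f s w - y w) ^+ 2) @[s --> \oo] --> 0].
Proof.
move=> mf if2 cauchy_f.
have /choice[N NP] : forall k, exists Nk, forall s t, (Nk <= s)%N -> (Nk <= t)%N ->
    Ex Pr (fun w => (f s w - f t w) ^+ 2) <= ((2 : R)^-1 ^+ k) ^+ 2.
  by move=> k; apply: cauchy_f; rewrite !exprn_gt0 // invr_gt0.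
(* A sum dominates every [N j] with [j <= k], although [N] need not be monotone. *)
pose phi k := (\sum_(j < k.+1) N j)%N.
have phiN k j : (j <= k)%N -> (N j <= phi k)%N.
  move=> jk; rewrite /phi (bigD1 (Ordinal (jk : (j < k.+1)%N))) //=.
  exact: leq_addr.
pose g k := f (phi k).
have mg k : measurable_fun setT (g k) by exact: mf.
have if2B s t : L1 Pr (fun w => (f s w - f t w) ^+ 2).
  apply: (L1_le _ (L1D (L1Z 2 (if2 s)) (L1Z 2 (if2 t)))).
    by apply: measurable_funX; exact: measurable_funB.
  move=> w; rewrite ger0_norm ?sqr_ge0 //.
  by have := sqr_ge0 (f s w + f t w); rewrite sqrrD sqrrB; lra.
pose h k w := `|g k.+1 w - g k w|.
have h_ge0 k w : 0 <= h k w by exact: normr_ge0.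
have mgB k : measurable_fun setT (fun w => g k.+1 w - g k w).
  exact: measurable_funB.
have mh k : measurable_fun setT (h k) by exact: measurableT_comp.
have ih k : L1 Pr (h k) by exact: L1_norm (L1_sqr (mgB k) (if2B _ _)).
have Exh k : Ex Pr (h k) <= 2^-1 ^+ k.
  have h0 : 0 <= Ex Pr (h k) by apply: Ex_ge0 => w; exact: normr_ge0.
  rewrite -(@ler_pXn2r _ 2) ?nnegrE ?exprn_ge0 ?invr_ge0 //.
  apply: le_trans (Ex_norm_sqr (mgB k) (if2B _ _)) _.
  by apply: NP; apply: phiN => //; exact: leqnSn.
(* The total variation of the subsequence at [w]; its integral is at most the sum of the 2^-k, so it
   is finite almost everywhere. *)
pose H w := (\sum_(0 <= k <oo) (h k w)%:E)%E.
have H_ge0 w : (0 <= H w)%E by apply: nneseries_ge0 => k _ _; rewrite lee_fin.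
have iH : Pr.-integrable setT H.
  apply/integrableP; split.
    apply: ge0_emeasurable_sum => [k w _ _|k _]; first by rewrite lee_fin.
    exact/measurable_EFinP.
  under eq_integral do rewrite gee0_abs //.
  rewrite integral_nneseries //; last 2 first.
  - by move=> k; exact/measurable_EFinP.
  - by move=> k w _; rewrite lee_fin.
  apply: (@le_lt_trans _ _ (\sum_(0 <= k <oo) (2^-1 ^+ k)%:E)%E).
    apply: lee_nneseries => [k _ _|k _].
      by apply: integral_ge0 => w _; rewrite lee_fin.
    by rewrite -EFin_Ex // lee_fin.
  apply: (@le_lt_trans _ _ 2%:E); last exact: ltry.
  apply: lime_le; first by apply: is_cvg_nneseries => k _ _; rewrite lee_fin exprn_ge0.
  apply: nearW => k; rewrite sumEFin lee_fin.
  have : \sum_(0 <= j < k) 2^-1 ^+ j + 2 * 2^-1 ^+ k = 2 :> R.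
    elim: k => [|k IH]; first by rewrite big_geq // add0r mulr1.
    by rewrite big_nat_recr //= -[RHS]IH exprS; field.
  have : 0 <= (2 : R)^-1 ^+ k by rewrite exprn_ge0 // invr_ge0.
  by lra.
(* An upper limit is measurable even where the subsequence diverges; where it is infinite, [fine]
   returns 0. *)
pose y w := fine (limn_esup (fun k => (g k w)%:E)).
have my : measurable_fun setT y.
  apply: (measurableT_comp (fine_measurable _)) => //.
  by apply: measurable_fun_limn_esup => k; exact/measurable_EFinP.
have gy : {ae Pr, forall w, g k w @[k --> \oo] --> y w}.
  have := integrable_ae measurableT iH; apply: filterS => w /(_ I) Hfin.
  have gcvg : cvgn (g ^~ w).
    have : cvgn (series (fun k => g k.+1 w - g k w)).
      apply: normed_cvg; apply: nondecreasing_is_cvgn.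
        by apply/nondecreasing_seqP => k; rewrite /= /series /= big_nat_recr //= lerDl.
      exists (fine (H w)) => _ [k _ <-].
      rewrite -lee_fin fineK // /= /series /= -sumEFin.
      by apply: nneseries_lim_ge => j _; rewrite lee_fin.
    have -> : series (fun k => g k.+1 w - g k w) = (fun k => g k w - g 0%N w).
      by rewrite -[LHS]/(series (telescope (g ^~ w))) telescopeK.
    move=> /cvg_ex[l gl]; apply/cvg_ex; exists (l + g 0%N w).
    have -> : g ^~ w = (fun k => (g k w - g 0%N w) + g 0%N w).
      by apply/funext => k; rewrite subrK.
    by apply: cvgD gl _; exact: cvg_cst.
  move: gcvg => /cvg_ex[l gl].
  have gl' : (g k w)%:E @[k --> \oo] --> l%:E by apply: cvg_EFin => //; exact: nearW.
  by rewrite /y (cvg_limn_einf_sup gl').2.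
have fatou_le k s : (N k <= s)%N ->
    (\int[Pr]_w ((f s w - y w) ^+ 2)%:E <= ((2^-1 ^+ k) ^+ 2)%:E)%E.
  move=> Nks.
  have mq j : measurable_fun setT (fun w => ((f s w - g j w) ^+ 2)%:E).
    by apply/measurable_EFinP; apply: measurable_funX; exact: measurable_funB.
  apply: (@le_trans _ _ (\int[Pr]_w limn_einf (fun j => ((f s w - g j w) ^+ 2)%:E))%E).
    rewrite le_eqVlt; apply/predU1P; left; apply: ae_eq_integral => //.
    - by apply/measurable_EFinP; apply: measurable_funX; exact: measurable_funB.
    - have -> : (fun w => limn_einf (fun j => ((f s w - g j w) ^+ 2)%:E)) =
          (fun w => - limn_esup (fun j => - ((f s w - g j w) ^+ 2)%:E))%E.
        by apply/funext => w; rewrite -[RHS]limn_einfN; congr limn_einf;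
          apply/funext => j /=; rewrite opprK.
      apply: measurableT_comp => //; apply: measurable_fun_limn_esup => j.
      exact: measurableT_comp.
    - apply: filterS gy => w gyw _; apply/esym/(cvg_limn_einf_sup _).1.
      apply: cvg_EFin; first exact: nearW.
      have fgy : (f s w - g j w) @[j --> \oo] --> f s w - y w.
        by apply: cvgB => //; exact: cvg_cst.
      by rewrite expr2; under eq_fun do rewrite expr2; exact: cvgM.
  apply: le_trans (fatou _ _ mq _) _ => //.
    by move=> j w _; rewrite lee_fin sqr_ge0.
  rewrite limn_einf_lim; apply: lime_le; first exact: is_cvg_einfs.
  (* The infimum over the indices from [m] on is at most the term at [maxn m k], to which the Cauchy
     estimate of level [k] applies. *)
  apply: nearW => m; apply: (@le_trans _ _ (\int[Pr]_w ((f s w - g (maxn m k) w) ^+ 2)%:E)%E).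
    apply: ereal_inf_lbound; exists (maxn m k) => //=; exact: leq_maxl.
  rewrite -EFin_Ex; last exact: if2B.
  rewrite lee_fin; apply: NP => //.
  by apply: phiN; exact: leq_maxr.
have ify s : L1 Pr (fun w => (f s w - y w) ^+ 2) -> L1 Pr (fun w => y w ^+ 2).
  move=> ifs; apply: (L1_le _ (L1D (L1Z 2 (if2 s)) (L1Z 2 ifs))).
    exact: measurable_funX.
  move=> w; rewrite ger0_norm ?sqr_ge0 //.
  by have := sqr_ge0 (2 * f s w - y w); nra.
have ifsy k s : (N k <= s)%N -> L1 Pr (fun w => (f s w - y w) ^+ 2).
  move=> Nks; apply: L1_ge0.
  - by apply: measurable_funX; exact: measurable_funB.
  - by move=> w; exact: sqr_ge0.
  - exact: le_lt_trans (fatou_le k s Nks) (ltry _).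
exists y; split=> //; first exact: ify (ifsy 0%N (N 0%N) (leqnn _)).
apply/cvgrPdist_le => e e0.
have [k ke] : exists k, ((2 : R)^-1 ^+ k) ^+ 2 <= e.
  have : ((2 : R)^-1 ^+ 2) ^+ k @[k --> \oo] --> 0.
    by apply: cvg_expr; rewrite ger0_norm ?exprn_ge0 ?invr_ge0 // exprn_ilt1 ?invr_ge0 // invf_lt1 ?ltr1n.
  move=> /cvgrPdist_le/(_ e e0)[k _ /(_ k (leqnn k))] /=.
  rewrite sub0r normrN ger0_norm ?exprn_ge0 ?invr_ge0 // => le_e; exists k.
  by rewrite -exprM mulnC exprM.
exists (N k) => // s /= Nks.
rewrite sub0r normrN ger0_norm ?Ex_ge0 // => [|w]; last exact: sqr_ge0.
apply: le_trans ke; rewrite -lee_fin EFin_Ex; first exact: fatou_le.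
exact: ifsy Nks.
Qed.

Lemma vL2_complete n (X : nat -> T -> 'cV[R]_n) : (forall s, vL2 Pr (X s)) ->
  (forall e, 0 < e -> exists N, forall s t, (N <= s)%N -> (N <= t)%N ->
    Ex Pr (fun w => nsq (X s w - X t w)) <= e) ->
  exists y : T -> 'cV[R]_n, vL2 Pr y /\
    Ex Pr (fun w => nsq (X s w - y w)) @[s --> \oo] --> 0.
Proof.
move=> X2 cauchyX.
have coord_lim i : exists y : T -> R, [/\ measurable_fun setT y,
    L1 Pr (fun w => y w ^+ 2)
  & Ex Pr (fun w => (X s w i 0 - y w) ^+ 2) @[s --> \oo] --> 0].
  apply: (L2_complete (f := fun s w => X s w i 0)).
  - by move=> s; exact: (X2 s).1.
  - by move=> s; exact: vL2_coord.
  move=> e /cauchyX[N NP]; exists N => s t Ns Nt; apply: le_trans (NP s t Ns Nt).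
  have B2 := vL2B (X2 s) (X2 t).
  have iB : L1 Pr (fun w => (X s w i 0 - X t w i 0) ^+ 2).
    by have := vL2_coord i B2; under eq_fun do rewrite !mxE.
  apply: Ex_le => //; first exact: B2.2.
  by move=> w; have := coord_sqr_le (X s w - X t w) i; rewrite !mxE.
have /choice[y yP] := coord_lim.
exists (fun w => \col_i y i w).
have y2 : vL2 Pr (fun w => \col_i y i w : 'cV[R]_n).
  split=> [i|]; first by under eq_fun do rewrite mxE; have [] := yP i.
  rewrite (_ : (fun w => _) = (fun w => \sum_i y i w ^+ 2)).
    by apply: L1_sum => i; have [] := yP i.
  by apply/funext => w; apply: eq_bigr => i _; rewrite mxE.
split=> //.
have -> : (fun s => Ex Pr (fun w => nsq (X s w - \col_i y i w))) =
    (fun s => \sum_i Ex Pr (fun w => (X s w i 0 - y i w) ^+ 2)).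
  apply/funext => s; rewrite -Ex_sum.
    congr Ex; apply/funext => w; apply: eq_bigr => i _.
    by rewrite !mxE.
  move=> i; have := vL2_coord i (vL2B (X2 s) y2).
  by under eq_fun do rewrite !mxE.
rewrite -[X in _ --> X](_ : \sum_(i < n) (0 : R) = 0); last by rewrite big1.
apply: cvg_big => [|i _]; first exact: add_continuous.
by have [] := yP i.
Qed.

End Completeness.

(** * Mean-square convergence *)

Section Convergence.
Context (d : measure_display) (T : measurableType d) (R : realType).
Variable Pr : probability T R.
Context (n : nat) (a : nat -> R).
Context (Pm : nat -> T -> 'M[R]_n) (u x : nat -> T -> 'cV[R]_n).
Context (x0 : 'cV[R]_n) (P : 'M[R]_n).
Hypothesis traj : is_trajectory a Pm u x0 x.
Hypothesis hA1 : A1 Pr x Pm u P 0.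
Local Open Scope classical_set_scope.
Local Open Scope ring_scope.

Local Notation A := (P - 1%:M).
Local Notation xi := (noise Pm u x P).

Let x2 s : vL2 Pr (x s) := vL2_state traj hA1 s.
Let xi2 s : vL2 Pr (xi s) := vL2_noise traj hA1 s.

Lemma dotv_mulmx m (D : 'M[R]_(m, n)) (y : 'cV[R]_m) (v : 'cV[R]_n) :
  dotv y (D *m v) = dotv (D^T *m y) v.
Proof.
rewrite /dotv; under eq_bigr do rewrite mxE mulr_sumr.
under [RHS]eq_bigr do rewrite mxE mulr_suml.
rewrite exchange_big /=; apply: eq_bigr => j _; apply: eq_bigr => i _.
by rewrite mxE; ring.
Qed.

Lemma smeas_mulmx m l (D : 'M[R]_(m, l)) s (Y : T -> 'cV[R]_l) :
  (forall i, smeas (state_events x s) (fun w => Y w i 0)) ->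
  forall i, smeas (state_events x s) (fun w => (D *m Y w) i 0).
Proof.
move=> sY i; under eq_fun do rewrite mxE.
apply: measurable_sum => j; apply: measurable_funM; last exact: sY.
exact: measurable_cst.
Qed.

(** Pythagoras: [Y] is determined by the past, so it is orthogonal to the noise. *)
Lemma Ex_nsq_noise m (D : 'M[R]_(m, n)) s (c : R) (Y : T -> 'cV[R]_m) :
  (forall i, smeas (state_events x s) (fun w => Y w i 0)) -> vL2 Pr Y ->
  Ex Pr (fun w => nsq (Y w + c *: (D *m xi s w))) =
  Ex Pr (fun w => nsq (Y w)) + c ^+ 2 * Ex Pr (fun w => nsq (D *m xi s w)).
Proof.
move=> sY Y2; have D2 := vL2_mulmx D (xi2 s).
have iYD := L1_dotv Y2 D2.
rewrite (_ : (fun w => _) = (fun w => nsq (Y w) +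
   2 * c * dotv (Y w) (D *m xi s w) + c ^+ 2 * nsq (D *m xi s w))); last first.
  by apply/funext => w; rewrite nsqDZ.
rewrite ExD; [|by apply: L1D; [exact: Y2.2|exact: L1Z]|by apply: L1Z; exact: D2.2].
rewrite ExD; [|exact: Y2.2|exact: L1Z].
rewrite (ExZ (c ^+ 2)); last exact: D2.2.
have dot0 : Ex Pr (fun w => dotv (Y w) (D *m xi s w)) = 0.
  under eq_fun do rewrite dotv_mulmx.
  apply: (Ex_dotv_noise traj hA1); last exact: vL2_mulmx.
  exact: smeas_mulmx.
by rewrite ExZ // dot0 mulr0 addr0.
Qed.

Lemma Ex_nsq_step m (D : 'M[R]_(m, n)) s :
  Ex Pr (fun w => nsq (D *m x s.+1 w)) =
  Ex Pr (fun w => nsq (D *m x s w + a s *: (D *m (A *m x s w)))) +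
  a s ^+ 2 * Ex Pr (fun w => nsq (D *m xi s w)).
Proof.
rewrite -Ex_nsq_noise.
- by congr Ex; apply/funext => w; rewrite (state_step P traj) 2!mulmxDr -!scalemxAr.
- move=> i; rewrite (_ : (fun w => _) =
    (fun w => ((D + a s *: (D *m A)) *m x s w) i 0)).
    by apply: smeas_mulmx => j; exact: smeas_coord.
  by apply/funext => w; rewrite [in RHS]mulmxDl -[in RHS]scalemxAl -mulmxA.
- apply: vL2D; first exact: vL2_mulmx.
  by apply: vL2Z; do 2!apply: vL2_mulmx.
Qed.

(** * Convergence and consensus from the spectral projection *)

Section Sufficiency.
Hypothesis a_ge0 : forall s, 0 <= a s.
Hypothesis sum_a : unbounded_sums a.
Hypothesis sum_a2 : bounded_sums (fun s => a s ^+ 2).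
Context (Pi : 'M[R]_n).
Hypothesis APi : A *m Pi = 0.
Hypothesis PiA : Pi *m A = 0.
Hypothesis Pi2 : Pi *m Pi = Pi.
Hypothesis stable : forall z, eigenvalue (mxC (A - Pi)) z -> complex.Re z < 0.

Local Notation z s w := ((1%:M - Pi) *m x s w).

Let Pi_step s : Ex Pr (fun w => nsq (Pi *m x s.+1 w)) =
  Ex Pr (fun w => nsq (Pi *m x s w)) + a s ^+ 2 * Ex Pr (fun w => nsq (Pi *m xi s w)).
Proof.
rewrite Ex_nsq_step; congr (Ex _ _ + _); apply/funext => w.
by rewrite mulmxA PiA mul0mx scaler0 addr0.
Qed.

Let Ex_nsq_le m l (D : 'M[R]_(m, l)) (K : R) (Y : T -> 'cV[R]_l) :
  (forall v, nsq (D *m v) <= K * nsq v) -> vL2 Pr Y ->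
  Ex Pr (fun w => nsq (D *m Y w)) <= K * Ex Pr (fun w => nsq (Y w)).
Proof.
move=> DK Y2; rewrite -ExZ; last exact: Y2.2.
apply: Ex_le => [||w]; last exact: DK.
- exact: (vL2_mulmx D Y2).2.
- exact: L1Z Y2.2.
Qed.

Let ExN0 m (Y : T -> 'cV[R]_m) : 0 <= Ex Pr (fun w => nsq (Y w)).
Proof. by apply: Ex_ge0 => w; exact: nsq_ge0. Qed.

(* [V s = E |D x(s)|^2], with [D = Q (1 - Pi)], is a Lyapunov function of the
   part of the state transversal to the kernel of [P - 1]. *)
Let transversal_bounds :
  (exists C, forall s, Ex Pr (fun w => nsq (x s w)) <= C) /\
  Ex Pr (fun w => nsq (z s w)) @[s --> \oo] --> 0.
Proof.
have [Q [c [k [c0 k0 Qk Qc]]]] := lyapunov stable.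
pose D := Q *m (1%:M - Pi).
(* [Q] is adapted to [A - Pi] rather than to [A]; the two agree on the range of [1 - Pi]. *)
have D_A : D *m A = Q *m (A - Pi) *m (1%:M - Pi).
  rewrite /D -!mulmxA; congr (_ *m _).
  have -> : (1%:M - Pi) *m A = A by rewrite mulmxBl mul1mx PiA subr0.
  by rewrite mulmxBr mulmx1 mulmxBl APi Pi2 sub0r opprK subrK.
pose V s := Ex Pr (fun w => nsq (D *m x s w)).
pose W s := Ex Pr (fun w => nsq (Pi *m x s w)).
pose N s := Ex Pr (fun w => nsq (x s w)).
have V0 s : 0 <= V s by exact: ExN0.
have W0 s : 0 <= W s by exact: ExN0.
have N0 s : 0 <= N s by exact: ExN0.
have [K K0 noiseK] := noise_bound traj hA1.
have [KD KD0 leKD] := nsq_mulmx D.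
have [KP KP0 leKP] := nsq_mulmx Pi.
have [KA KA0 leKA] := nsq_mulmx (Q *m (A - Pi)).
have D2 s : vL2 Pr (fun w => D *m x s w) by exact: vL2_mulmx.
have P2 s : vL2 Pr (fun w => Pi *m x s w) by exact: vL2_mulmx.
have z_le s : Ex Pr (fun w => nsq (z s w)) <= k^-1 * V s.
  rewrite -ExZ; last exact: (D2 s).2.
  apply: Ex_le => [||w].
  - by have [] : vL2 Pr (fun w => z s w) by exact: vL2_mulmx.
  - exact: L1Z (D2 s).2.
  rewrite mulrC ler_pdivlMr // mulrC.
  by apply: le_trans (Qk _) _; rewrite mulmxA.
(* The noise in the recursion of [V] involves the full second moment [N]; [W] accounts for the
   component that [V] does not see. *)
have N_le s : N s <= 2 * k^-1 * V s + 2 * W s.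
  have z2 : vL2 Pr (fun w => z s w) by exact: vL2_mulmx.
  apply: (@le_trans _ _ (2 * Ex Pr (fun w => nsq (z s w)) + 2 * W s)); last first.
    by rewrite lerD2r -mulrA ler_pM2l.
  rewrite -ExZ; last exact: z2.2.
  rewrite -ExZ; last exact: (P2 s).2.
  rewrite -ExD; [|exact: L1Z z2.2|exact: L1Z (P2 s).2].
  apply: Ex_le => [||w]; first exact: (x2 s).2.
    by apply: L1D; [exact: L1Z z2.2|exact: L1Z (P2 s).2].
  apply: le_trans (nsqD_le _ _).
  by rewrite -mulmxDl subrK mul1mx.
have V_step s : V s.+1 <= V s - 2 * c * a s * V s +
    a s ^+ 2 * (KA * k^-1 * V s + KD * (K * (1 + N s))).
  rewrite /V Ex_nsq_step -/(V s).
  have DA2 : vL2 Pr (fun w => D *m (A *m x s w)) by do 2!apply: vL2_mulmx.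
  have drift : Ex Pr (fun w => nsq (D *m x s w + a s *: (D *m (A *m x s w)))) <=
      V s - 2 * c * a s * V s + a s ^+ 2 * (KA * k^-1 * V s).
    rewrite (_ : V s - _ + _ =
      (1 - 2 * c * a s + a s ^+ 2 * (KA * k^-1)) * V s); last by ring.
    rewrite -ExZ; last exact: (D2 s).2.
    apply: Ex_le => [||w].
    - by have [] : vL2 Pr (fun w => D *m x s w + a s *: (D *m (A *m x s w)))
        by apply: vL2D => //; exact: vL2Z.
    - exact: L1Z (D2 s).2.
    have DAE : D *m (A *m x s w) = Q *m ((A - Pi) *m z s w).
      by rewrite mulmxA D_A -!mulmxA.
    have DE : D *m x s w = Q *m z s w by rewrite mulmxA.
    rewrite nsqDZ DAE DE.
    have h1 := Qc (z s w).
    have h2 : nsq (Q *m ((A - Pi) *m z s w)) <= KA * k^-1 * nsq (Q *m z s w).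
      rewrite mulmxA; apply: le_trans (leKA _) _.
      rewrite -mulrA ler_wpM2l // mulrC ler_pdivlMr // mulrC; exact: Qk.
    have h3 : 2 * a s * dotv (Q *m z s w) (Q *m ((A - Pi) *m z s w)) <=
        2 * a s * (- c * nsq (Q *m z s w)) by rewrite ler_wpM2l // mulr_ge0.
    have h4 := ler_wpM2l (sqr_ge0 (a s)) h2.
    rewrite (_ : (1 - _ + _) * _ = nsq (Q *m z s w) +
      2 * a s * (- c * nsq (Q *m z s w)) +
      a s ^+ 2 * (KA * k^-1 * nsq (Q *m z s w))); last by ring.
    by rewrite lerD // lerD.
  have diffusion : Ex Pr (fun w => nsq (D *m xi s w)) <= KD * (K * (1 + N s)).
    by apply: (le_trans (Ex_nsq_le leKD (xi2 s))); rewrite ler_wpM2l.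
  by rewrite mulrDr addrA lerD // ler_wpM2l ?sqr_ge0.
have W_step s : W s.+1 <= W s + a s ^+ 2 * (KP * (K * (1 + N s))).
  rewrite /W Pi_step lerD2l ler_wpM2l ?sqr_ge0 //.
  by apply: (le_trans (Ex_nsq_le leKP (xi2 s))); rewrite ler_wpM2l.
(* The summand 1 absorbs the constant of the noise bound and makes the recursion homogeneous, as
   [gronwall] requires. The term of order [a s] is nonpositive and is dropped here. *)
have [L L0 LP] : exists2 L : R, 0 <= L & forall s,
    1 + (V s.+1 + W s.+1) <= (1 + L * a s ^+ 2) * (1 + (V s + W s)).
  pose H := (KD + KP) * K; have H0 : 0 <= H by rewrite mulr_ge0 ?addr_ge0.
  have ki0 : 0 <= k^-1 by rewrite invr_ge0 ltW.
  exists (KA * k^-1 + H * (1 + 2 * k^-1 + 2)) => [|s].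
    by rewrite addr_ge0 ?mulr_ge0 ?addr_ge0 ?mulr_ge0.
  have h1 : V s.+1 + W s.+1 <= V s + W s +
      a s ^+ 2 * (KA * k^-1 * V s + H * (1 + N s)).
    apply: (le_trans (lerD (V_step s) (W_step s))).
    have h0 : 0 <= 2 * c * a s * V s by rewrite !mulr_ge0 // ltW.
    rewrite /H; set v1 := _ ^+ 2; set v2 := _ * _ * _ in h0 *.
    rewrite -subr_ge0 (_ : _ - _ = v2) //; ring.
  have h2 : KA * k^-1 * V s + H * (1 + N s) <=
      (KA * k^-1 + H * (1 + 2 * k^-1 + 2)) * (1 + (V s + W s)).
    have e1 : KA * k^-1 * V s <= KA * k^-1 * (1 + (V s + W s)).
      by rewrite ler_wpM2l ?mulr_ge0 //; have := V0 s; have := W0 s; lra.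
    have e2 : 1 + N s <= (1 + 2 * k^-1 + 2) * (1 + (V s + W s)).
      have := N_le s; have := V0 s; have := W0 s.
      have := mulr_ge0 ki0 (W0 s); have := mulr_ge0 ki0 (V0 s); lra.
    rewrite mulrDl lerD // -mulrA; exact: ler_wpM2l.
  have := ler_wpM2l (sqr_ge0 (a s)) h2.
  by lra.
have [C CP] : exists C, forall s, 1 + (V s + W s) <= C.
  apply: (@gronwall _ (fun s => L * a s ^+ 2)) => //.
  - by move=> s; rewrite mulr_ge0 ?sqr_ge0.
  - by move=> s; rewrite !addr_ge0.
  case: sum_a2 => C0 C0P; exists (L * C0) => M.
  by rewrite -mulr_sumr ler_wpM2l.
have ki0 : 0 <= k^-1 by rewrite invr_ge0 ltW.
have VC s : V s <= C by have := CP s; have := W0 s; lra.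
have NC s : N s <= 2 * k^-1 * C + 2 * C.
  apply: (le_trans (N_le s)); apply: lerD.
    by rewrite ler_wpM2l ?mulr_ge0.
  by have := CP s; have := V0 s; lra.
split; first by eexists; exact: NC.
(* With [V] and [N] now bounded, all terms of order [a s ^+ 2] are summable, and the decrement
   [2 * c * a s * V s] forces the limit 0. *)
have V_cvg : V @ \oo --> 0.
  pose L' := KA * k^-1 * C + KD * (K * (1 + (2 * k^-1 * C + 2 * C))).
  have C_ge0 : 0 <= C := le_trans (V0 0%N) (VC 0%N).
  have L'0 : 0 <= L'.
    apply: addr_ge0; first by rewrite !mulr_ge0.
    do 2!apply: mulr_ge0 => //; apply: addr_ge0 => //.
    by apply: le_trans (N0 0%N) (NC 0%N).
  apply: (@contraction_cvg0 _ a (fun s => L' * a s ^+ 2) V (2 * c)) => //.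
  - by rewrite mulr_gt0.
  - by move=> s; rewrite mulr_ge0 ?sqr_ge0.
  - case: sum_a2 => C0 C0P; exists (L' * C0) => M.
    by rewrite -mulr_sumr ler_wpM2l.
  move=> s; apply: (le_trans (V_step s)); rewrite lerD2l mulrC.
  rewrite ler_wpM2r ?sqr_ge0 // /L' lerD //.
    by rewrite ler_wpM2l ?mulr_ge0.
  by rewrite !ler_wpM2l // lerD2l.
exact: cvg0_le (fun s => ExN0 _) z_le V_cvg.
Qed.

Lemma state_cvg : exists y : T -> 'cV[R]_n, vL2 Pr y /\
  Ex Pr (fun w => nsq (x s w - y w)) @[s --> \oo] --> 0.
Proof.
have [[C NC] z_cvg] := transversal_bounds.
have [K K0 noiseK] := noise_bound traj hA1.
have [KP KP0 leKP] := nsq_mulmx Pi.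
pose L := KP * (K * (1 + C)).
(* By induction on [k]: the new increment is orthogonal to the difference accumulated so far. *)
have incr_le s k : Ex Pr (fun w => nsq (Pi *m x (s + k)%N w - Pi *m x s w)) <=
    \sum_(s <= j < s + k) L * a j ^+ 2.
  elim: k => [|k IH].
    rewrite addn0 big_geq // (_ : (fun w => _) = cst 0) ?Ex_cst //.
    by apply/funext => w; rewrite subrr /nsq big1 // => i _; rewrite mxE expr0n.
  rewrite addnS big_nat_recr ?leq_addr //=.
  rewrite (_ : (fun w => _) = (fun w => nsq
      ((Pi *m x (s + k)%N w - Pi *m x s w) + a (s + k)%N *: (Pi *m xi (s + k)%N w)))).
    rewrite Ex_nsq_noise; last 2 first.
    - move=> i; under eq_fun do rewrite mxE [X in _ + X]mxE.
      apply: measurable_funB.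
        by apply: smeas_mulmx => j; exact: smeas_coord.
      by apply: smeas_mulmx => j; apply: smeas_coord; exact: leq_addr.
    - by apply: vL2B; exact: vL2_mulmx.
    rewrite lerD // mulrC ler_wpM2r ?sqr_ge0 //.
    apply: (le_trans (Ex_nsq_le leKP (xi2 _))); rewrite ler_wpM2l //.
    by apply: (le_trans (noiseK _)); rewrite ler_wpM2l // lerD2l.
  apply/funext => w; rewrite (state_step P traj) 2!mulmxDr -!scalemxAr.
  by rewrite [Pi *m (A *m _)]mulmxA PiA mul0mx scaler0 addr0 addrAC.
have C_ge0 : 0 <= C by apply: le_trans (NC 0%N); exact: ExN0.
have L0 : 0 <= L by rewrite /L !mulr_ge0 // addr_ge0.
have P2 s : vL2 Pr (fun w => Pi *m x s w) by exact: vL2_mulmx.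
have [y [y2 Py]] : exists y : T -> 'cV[R]_n, vL2 Pr y /\
    Ex Pr (fun w => nsq (Pi *m x s w - y w)) @[s --> \oo] --> 0.
  apply: vL2_complete => // e e0.
  have [N NP] : exists N, forall s t, (N <= s)%N -> (s <= t)%N ->
      \sum_(s <= j < t) L * a j ^+ 2 <= e.
    apply: bounded_sums_tail => // [s|]; first by rewrite mulr_ge0 ?sqr_ge0.
    case: sum_a2 => C0 C0P; exists (L * C0) => M.
    by rewrite -mulr_sumr ler_wpM2l.
  exists N => s t; wlog st : s t / (s <= t)%N => [wl|] Ns Nt.
    have [st|/ltnW ts] := leqP s t; first exact: wl.
    apply: le_trans (wl t s ts Nt Ns); rewrite le_eqVlt; apply/predU1P; left.
    congr Ex; apply/funext => w; apply: eq_bigr => i _.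
    by rewrite -opprB mxE sqrrN.
  rewrite (_ : (fun w => _) = (fun w => nsq (Pi *m x t w - Pi *m x s w))).
    by rewrite -(subnKC st); apply: le_trans (incr_le _ _) _; apply: NP; rewrite ?leq_addr.
  by apply/funext => w; apply: eq_bigr => i _; rewrite -opprB mxE sqrrN.
exists y; split=> //.
apply: (cvg0_le (K := 2) (g := fun s => Ex Pr (fun w => nsq (z s w)) +
    Ex Pr (fun w => nsq (Pi *m x s w - y w)))) => //.
  move=> s; have z2 : vL2 Pr (fun w => z s w) by exact: vL2_mulmx.
  have Py2 := vL2B (P2 s) y2; have xy2 := vL2B (x2 s) y2.
  rewrite mulrDr -ExZ; last exact: z2.2.
  rewrite -ExZ; last exact: Py2.2.
  rewrite -ExD; [|exact: L1Z z2.2|exact: L1Z Py2.2].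
  apply: Ex_le => [||w]; first exact: xy2.2.
    by apply: L1D; [exact: L1Z z2.2|exact: L1Z Py2.2].
  apply: le_trans (nsqD_le _ _); rewrite addrA -mulmxDl subrK mul1mx.
  exact: lexx.
by rewrite -[X in _ --> X](addr0 0); exact: cvgD.
Qed.

(** As rows [i] and [j] of [Pi] agree, x_i(s) - x_j(s) depends only on (1 - Pi) x(s), which tends to
    0 in mean square. *)
Lemma consensus_cvg i j : (forall l, Pi i l = Pi j l) ->
  Ex Pr (fun w => `|x s w i 0 - x s w j 0|) @[s --> \oo] --> 0.
Proof.
move=> Pij; have [_ z_cvg] := transversal_bounds.
pose g s := Ex Pr (fun w => (x s w i 0 - x s w j 0) ^+ 2).
have m_ij s : measurable_fun setT (fun w => x s w i 0 - x s w j 0).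
  by apply: measurable_funB; exact: (x2 s).1.
have xzE s w : x s w i 0 - x s w j 0 = (z s w) i 0 - (z s w) j 0.
  rewrite !mulmxBl !mul1mx ![(_ - _ *m _) _ _]mxE ![(- (_ *m _)) _ _]mxE.
  rewrite (_ : (Pi *m x s w) i 0 = (Pi *m x s w) j 0); first by ring.
  by rewrite !mxE; apply: eq_bigr => l _; rewrite Pij.
have sqr_le s w : (x s w i 0 - x s w j 0) ^+ 2 <= 4 * nsq (z s w).
  rewrite xzE; have := coord_sqr_le (z s w) i; have := coord_sqr_le (z s w) j.
  have := sqr_ge0 ((z s w) i 0 + (z s w) j 0); rewrite sqrrD sqrrB.
  by lra.
have z2 s : vL2 Pr (fun w => z s w) by exact: vL2_mulmx.
have i_ij s : L1 Pr (fun w => (x s w i 0 - x s w j 0) ^+ 2).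
  apply: (L1_le _ (L1Z 4 (z2 s).2)); first exact: measurable_funX.
  by move=> w; rewrite ger0_norm ?sqr_ge0.
apply: (cvg0_sqr (g := g)) => [s|]; first exact: Ex_norm_sqr.
apply: (cvg0_le (K := 4)) z_cvg => s.
  by apply: Ex_ge0 => w; exact: sqr_ge0.
by rewrite -ExZ; [apply: Ex_le => //; exact: L1Z (z2 s).2|exact: (z2 s).2].
Qed.

End Sufficiency.

(** * The deterministic recursion of the means *)

Section Mean.

Definition mean s : 'cV[R]_n := \col_i Ex Pr (fun w => x s w i 0).

Lemma mean0 : mean 0%N = x0.
Proof.
apply/matrixP => i j; rewrite ord1 mxE -[RHS](Ex_cst Pr).
by congr Ex; apply/funext => w; rewrite traj.1.
Qed.

Let L1_coord m (Y : T -> 'cV[R]_m) i : vL2 Pr Y -> L1 Pr (fun w => Y w i 0).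
Proof. by move=> Y2; apply: L1_sqr; [exact: Y2.1|exact: vL2_coord]. Qed.

Lemma meanS s : mean s.+1 = mean s + a s *: (A *m mean s).
Proof.
apply/matrixP => i j; rewrite ord1 [LHS]mxE.
rewrite (_ : (fun w => _) = (fun w => x s w i 0 +
    a s * (\sum_k A i k * x s w k 0) + a s * xi s w i 0)); last first.
  by apply/funext => w; rewrite (state_step P traj) !mxE.
have iA : L1 Pr (fun w => \sum_k A i k * x s w k 0).
  by apply: L1_sum => k; apply: L1Z; exact: L1_coord k (x2 s).
have ixi : L1 Pr (fun w => xi s w i 0) by exact: L1_coord i (xi2 s).
have ixs : L1 Pr (fun w => x s w i 0) by exact: L1_coord i (x2 s).
rewrite ExD; [|by apply: L1D => //; exact: L1Z|exact: L1Z].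
rewrite ExD //; last exact: L1Z.
rewrite !ExZ // (Ex_noise traj hA1) mulr0 addr0.
rewrite Ex_sum; last by move=> k; apply: L1Z; exact: L1_coord k (x2 s).
rewrite [RHS]mxE [mean s i 0]mxE [X in _ = _ + X]mxE [X in _ = _ + _ * X]mxE.
congr (_ + _ * _); apply: eq_bigr => k _; rewrite [mean s k 0]mxE.
by rewrite ExZ //; exact: L1_coord k (x2 s).
Qed.

Lemma mean_cvg : ms_convergent Pr x ->
  exists l : 'cV[R]_n, forall i, mean s i 0 @[s --> \oo] --> l i 0.
Proof.
move=> [y [my yfin xy]].
have y2 : vL2 Pr y.
  split=> //; apply: L1_ge0; first exact: measurable_nsq.
    by move=> w; exact: nsq_ge0.
  move: yfin; rewrite unlock.
  by under eq_integral do rewrite norm2_sqr.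
exists (\col_i Ex Pr (fun w => y w i 0)) => i; rewrite mxE.
have B2 s := vL2B (x2 s) y2.
have N_cvg : Ex Pr (fun w => nsq (x s w - y w)) @[s --> \oo] --> 0.
  have /fine_cvgP[_] := xy.
  apply: cvg_trans; apply: near_eq_cvg; apply: nearW => s /=.
  by rewrite unlock; under eq_integral do rewrite norm2_sqr.
have : (mean s i 0 - Ex Pr (fun w => y w i 0)) @[s --> \oo] --> 0.
  apply: cvg0_sqr N_cvg => s; rewrite mxE -ExB; [|exact: L1_coord i (x2 s)|exact: L1_coord i y2].
  have mB : measurable_fun setT (fun w => x s w i 0 - y w i 0).
    by apply: measurable_funB; [exact: (x2 s).1|exact: y2.1].
  have iB2 : L1 Pr (fun w => (x s w i 0 - y w i 0) ^+ 2).
    by have := vL2_coord i (B2 s); under eq_fun do rewrite !mxE.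
  have iB := L1_sqr mB iB2.
  apply: (@le_trans _ _ (Ex Pr (fun w => `|x s w i 0 - y w i 0|) ^+ 2)).
    rewrite -[leLHS]real_normK ?num_real //.
    rewrite lerXn2r ?nnegrE ?normr_ge0 //; last exact: Ex_norm.
    by apply: Ex_ge0 => w; exact: normr_ge0.
  apply: le_trans (Ex_norm_sqr mB iB2) _; apply: Ex_le => //; first exact: (B2 s).2.
  by move=> w; have := coord_sqr_le (x s w - y w) i; rewrite !mxE.
move=> h; rewrite -[X in _ --> X]add0r.
rewrite (_ : (fun s => mean s i 0) =
  (fun s => (mean s i 0 - Ex Pr (fun w => y w i 0)) + Ex Pr (fun w => y w i 0))).
  by apply: cvgD h _; exact: cvg_cst.
by apply/funext => s; rewrite subrK.
Qed.

Lemma drift_mean_cvg0 : (forall s, 0 <= a s) -> unbounded_sums a ->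
  ms_convergent Pr x -> forall i, (A *m mean s) i 0 @[s --> \oo] --> 0.
Proof.
move=> a0 ay /mean_cvg[l ml] i.
have Am : (A *m mean s) i 0 @[s --> \oo] --> (A *m l) i 0.
  under eq_fun do rewrite mxE; rewrite mxE.
  apply: cvg_big => [|k _]; first exact: add_continuous.
  by apply: cvgM => //; exact: cvg_cst.
rewrite -[X in _ --> X](_ : (A *m l) i 0 = 0) //.
apply: (increments_lim0 a0 ay (p := fun s => mean s i 0) _ (ml i) Am) => s.
by rewrite meanS !mxE.
Qed.

Lemma mean_consensus i j :
  ('E_Pr[(fun w => `|x s w i 0 - x s w j 0|)%R] @[s --> \oo] --> 0)%E ->
  (mean s i 0 - mean s j 0) @[s --> \oo] --> 0.
Proof.
move=> /fine_cvgP[_] xij.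
have ij2 s : L1 Pr (fun w => x s w i 0 - x s w j 0).
  exact: L1B (L1_coord i (x2 s)) (L1_coord j (x2 s)).
apply/norm_cvg0P; apply: (cvg0_le (K := 1)) xij => s; first exact: normr_ge0.
rewrite mul1r !mxE -ExB; [|exact: L1_coord i (x2 s)|exact: L1_coord j (x2 s)].
by apply: (le_trans (Ex_norm (ij2 s))); rewrite /= unlock.
Qed.

End Mean.

End Convergence.

(** * Necessity *)

Section Necessity.
Context (R : realType) (n : nat) (a : nat -> R) (P : 'M[R]_n).
Local Open Scope classical_set_scope.
Local Open Scope ring_scope.
Local Notation A := (P - 1%:M).
Hypothesis a_ge0 : forall s, 0 <= a s.
Context (m : 'cV[R]_n -> nat -> 'cV[R]_n).
Hypothesis m0 : forall v, m v 0%N = v.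
Hypothesis mS : forall v s, m v s.+1 = m v s + a s *: (A *m m v s).
Hypothesis Am_cvg : forall v i, (A *m m v s) i 0 @[s --> \oo] --> 0.

Lemma drift_kernel (v : 'cV[R]_n) : A *m v = 0 -> forall s, m v s = v.
Proof.
by move=> Av; elim=> [|s IH]; rewrite ?m0 // mS IH Av scaler0 addr0.
Qed.

(** Under this hypothesis [A *m m v s] never moves from [A *m v], yet it tends to 0. *)
Lemma drift_semisimple (v : 'cV[R]_n) : A *m (A *m v) = 0 -> A *m v = 0.
Proof.
move=> AAv.
have Amv s : A *m m v s = A *m v.
  by elim: s => [|s IH]; rewrite ?m0 // mS mulmxDr -scalemxAr IH AAv scaler0 addr0.
apply/matrixP => i j; rewrite ord1 [RHS]mxE.
have := Am_cvg v i; under eq_fun do rewrite Amv.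
by move=> /(cvg_lim (@norm_hausdorff _ _)); rewrite lim_cst.
Qed.

(* Along a right eigenvector [v] the mean is [p s *: v] with
   [p s.+1 = (1 + a s * (z - 1)) * p s], so [1 <= nsqC (p s)]. *)
Lemma drift_spectrum z : eigenvalue (mxC P) z -> complex.Re z < 1 \/ z = 1.
Proof.
move=> zP; have [Rez|Rez] := ltP (complex.Re z) 1; [by left|right].
have [mu zE] : exists mu, z = mu + 1 by exists (z - 1); rewrite subrK.
move: zP Rez; rewrite {}zE -eigenvalue_sub1 => /right_eigenvalueP[v Av v0].
rewrite ReD /= lerDr => Remu.
pose v1 : 'cV[R]_n := map_mx (@complex.Re R) v.
pose v2 : 'cV[R]_n := map_mx (@complex.Im R) v.
pose fix p s : R[i] :=
  if s is s'.+1 then (1 + (a s')%:C%C * mu) * p s' else 1.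
have ApE s : mxC A *m (p s *: v) = (mu * p s) *: v.
  by rewrite -scalemxAr Av scalerA mulrC.
(* [P] is real, so the means started at the two parts of [v] are the two parts of one complex
   trajectory. *)
have mE s : m v1 s = map_mx (@complex.Re R) (p s *: v) /\
            m v2 s = map_mx (@complex.Im R) (p s *: v).
  elim: s => [|s [IH1 IH2]]; first by rewrite !m0 scale1r.
  rewrite !mS IH1 IH2 !mulmx_Re !mulmx_Im !ApE; split; apply/matrixP => i j; rewrite !mxE.
    by rewrite !(ReM, ImM, ReD, ImD) /=; ring.
  by rewrite !(ReM, ImM, ReD, ImD) /=; ring.
have p_ge1 s : 1 <= nsqC (p s).
  elim: s => [|s IH]; first by rewrite /nsqC /= expr1n expr0n addr0.
  rewrite /= nsqCM; apply: (le_trans IH); rewrite ler_peMl ?nsqC_ge0 //.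
  rewrite /nsqC !(ReM, ImM, ReD, ImD) /= !mul0r subr0 add0r.
  have h := mulr_ge0 (a_ge0 s) Remu.
  rewrite -[X in X <= _]addr0 lerD ?sqr_ge0 //.
  by rewrite exprn_ege1 // lerDl; exact: h.
suff -> : mu = 0 by rewrite add0r.
have [i vi0] : exists i, v i 0 != 0.
  apply/existsP; apply: contraR v0 => /existsPn v0; apply/eqP/matrixP => i j.
  by rewrite ord1 mxE; apply/eqP; rewrite -[_ == _]negbK v0.
(* Since [1 <= nsqC (p s)], the drift at coordinate [i] keeps at least the modulus of [mu * v i 0];
   as it tends to 0, [mu] vanishes. *)
have le_q s : nsqC (mu * v i 0) <=
    (A *m m v1 s) i 0 ^+ 2 + (A *m m v2 s) i 0 ^+ 2.
  have [-> ->] := mE s; rewrite !mulmx_Re !mulmx_Im !ApE !mxE -/(nsqC _).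
  by rewrite mulrAC [leRHS]nsqCM ler_peMr ?nsqC_ge0.
have sq_cvg w : ((A *m m w s) i 0 ^+ 2) @[s --> \oo] --> (0 : R).
  rewrite -[X in _ --> X](mulr0 0); under eq_fun do rewrite expr2.
  by apply: cvgM; exact: Am_cvg.
have q_cvg : ((A *m m v1 s) i 0 ^+ 2 + (A *m m v2 s) i 0 ^+ 2) @[s --> \oo] --> (0 : R).
  by rewrite -[X in _ --> X](addr0 0); exact: cvgD.
have : nsqC (mu * v i 0) <= 0.
  rewrite -(cvg_lim (@norm_hausdorff _ _) q_cvg); apply: limr_ge.
    by apply/cvg_ex; exists 0.
  by apply: nearW => s; exact: le_q.
rewrite le_eqVlt ltNge nsqC_ge0 orbF /nsqC paddr_eq0 ?sqr_ge0 // !sqrf_eq0.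
move=> /andP[/eqP re0 /eqP im0].
have /eqP : mu * v i 0 = 0 by case: (mu * v i 0) re0 im0 => x y /= -> ->.
by rewrite mulf_eq0 (negPf vi0) orbF => /eqP.
Qed.

End Necessity.

(** * Vectors constant on the blocks of a partition *)

Section Blocks.
Context (R : realType) (n : nat) (S : {set {set 'I_n}}).
Hypothesis partS : finset.partition S [set: 'I_n]%SET.
Local Open Scope ring_scope.

Lemma mem_block (B C : {set 'I_n}) i : B \in S -> C \in S -> i \in B ->
  (i \in C) = (C == B).
Proof.
move=> BS CS iB; apply/idP/eqP => [iC|-> //].
have /and3P[_ /finset.trivIsetP tS _] := partS.
apply/eqP/negPn/negP => CB; have /pred0P/(_ i) := tS _ _ CS BS CB.
by rewrite /= iC iB.
Qed.

Lemma indicator_sum (c : {set 'I_n} -> R[i]) (B : {set 'I_n}) i : B \in S ->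
  i \in B -> (\sum_(C in S) c C *: indicator_vec R C) i 0 = c B.
Proof.
move=> BS iB; rewrite summxE (bigD1 B) //= !mxE iB mulr1 big1 ?addr0 //.
by move=> C /andP[CS CB]; rewrite !mxE (mem_block BS CS iB) (negPf CB) mulr0.
Qed.

Lemma block_constant (v : 'cV[R[i]]_n) :
  (forall B i j, B \in S -> i \in B -> j \in B -> v i 0 = v j 0) ->
  exists c : {set 'I_n} -> R[i], v = \sum_(B in S) c B *: indicator_vec R B.
Proof.
move=> vB; exists (fun B : {set 'I_n} => if [pick i in B] is Some i then v i 0 else 0).
apply/matrixP => i j; rewrite ord1.
have : i \in finset.cover S by have /and3P[/eqP -> _ _] := partS; rewrite inE.
case/finset.bigcupP => B BS iB; rewrite (indicator_sum _ BS iB).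
case: pickP => [k kB|/(_ i)]; last by rewrite iB.
exact: vB BS iB kB.
Qed.

(** The eigenspace lies in the span of the indicator vectors, which are the [#|S|] rows of [W]. *)
Lemma geom_mult_le_card (P : 'M[R]_n) :
  (forall v : 'cV[R[i]]_n, mxC P *m v = v ->
    exists c : {set 'I_n} -> R[i], v = \sum_(B in S) c B *: indicator_vec R B) ->
  (geom_mult P 1%R <= #|S|)%N.
Proof.
move=> Pv; pose W := \matrix_(b < #|S|) (indicator_vec R (enum_val b))^T.
apply: leq_trans (rank_leq_row W); apply: mxrankS; apply/row_subP => i.
set r := row i _.
have /Pv[c rc] : mxC P *m r^T = r^T.
  apply: trmx_inj; rewrite trmx_mul trmxK.
  have /eigenspaceP -> : (r <= eigenspace (mxC P)^T 1)%MS by exact: row_sub.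
  by rewrite scale1r.
rewrite -[r]trmxK rc linear_sum /=.
apply/summx_sub => B BS; rewrite linearZ /=; apply: scalemx_sub.
rewrite -(enum_rankK_in BS BS) -(rowK (fun b => (indicator_vec R (enum_val b))^T)).
exact: row_sub.
Qed.

End Blocks.

Local Open Scope ring_scope.

(* The noise u(s), and possibly the weights P(s), may depend on the state, so
   the whole driving process is indexed by the initial state x0. *)
Theorem theorem4p1 (R : realType) (d : measure_display) (T : measurableType d)
    (Pr : probability T R) (n : nat) (a : nat -> R)
    (Pm : 'cV[R]_n -> nat -> T -> 'M[R]_n)
    (u : 'cV[R]_n -> nat -> T -> 'cV[R]_n)
    (x : 'cV[R]_n -> nat -> T -> 'cV[R]_n)
    (P : 'M[R]_n) (S : {set {set 'I_n}}) :
  (0 < n)%N ->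
  (forall x0, is_trajectory a (Pm x0) (u x0) x0 (x x0)) ->
  (forall x0, A1 Pr (x x0) (Pm x0) (u x0) P 0) ->
  A2 a ->
  finset.partition S [set: 'I_n]%SET ->
  (forall x0, ms_group_consensus Pr S (x x0)) <->
  (rho_max P < 1 \/ (A5 S P /\ rho_max P = 1)).
Proof.
move=> n0 traj hA1 [a0 sum_a sum_a2] partS.
have ay := nneseries_unbounded a0 sum_a.
have a2b := nneseries_bounded (fun s => sqr_ge0 (a s)) sum_a2.
have [[zmax zmaxP zmaxE] rho_ge] := rho_maxP P n0.
pose A := P - 1%:M.
split=> [consensus|rhoP].
  pose m x0 := mean Pr (x x0).
  have m0 v : m v 0%N = v := mean0 Pr (traj v).
  have mS v s : m v s.+1 = m v s + a s *: (A *m m v s) := meanS (traj v) (hA1 v) s.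
  have Am_cvg v i := drift_mean_cvg0 (traj v) (hA1 v) a0 ay (consensus v).1 i.
  have spec := drift_spectrum a0 m0 mS Am_cvg.
  have semi := drift_semisimple m0 mS Am_cvg.
  have alg_geom : alg_mult P 1 = geom_mult P 1.
    by apply/(alg_geom_mult P).2; apply: unitmx_semisimple; exact: semi.
  (* Started in the kernel of [A], the mean stays at [v], so consensus on a block forces [v] to be
     constant there. *)
  have ker_block (v : 'cV[R]_n) B i j : A *m v = 0 -> B \in S -> i \in B ->
      j \in B -> v i 0 = v j 0.
    move=> Av BS iB jB.
    have := mean_consensus (traj v) (hA1 v) ((consensus v).2 B i j BS iB jB).
    under eq_fun do rewrite -[mean _ _ _]/(m v _) (drift_kernel m0 mS Av).
    move=> /(cvg_lim (@norm_hausdorff _ _)); rewrite lim_cst //.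
    by move=> /eqP; rewrite subr_eq0 => /eqP.
  have eigen_block (v : 'cV[R[i]]_n) : mxC P *m v = v ->
      exists c : {set 'I_n} -> R[i], v = \sum_(B in S) c B *: indicator_vec R B.
    move=> Pv; apply: (block_constant partS) => B i j BS iB jB.
    have Av : mxC A *m v = 0 by rewrite /A mxC_sub1 mulmxBl mul1mx Pv subrr.
    have ReA : A *m map_mx (@complex.Re R) v = 0.
      by rewrite mulmx_Re Av; apply/matrixP => k l; rewrite !mxE.
    have ImA : A *m map_mx (@complex.Im R) v = 0.
      by rewrite mulmx_Im Av; apply/matrixP => k l; rewrite !mxE.
    have := ker_block _ _ _ _ ReA BS iB jB; have := ker_block _ _ _ _ ImA BS iB jB.
    rewrite !mxE; case: (v i 0) (v j 0) => b1 b2 [c1 c2] /= -> ->.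
    by [].
  (* The eigenvalue of largest real part decides which alternative holds. *)
  have [Rez|z1] := spec _ zmaxP; [left; rewrite -zmaxE //|right].
  split; last by rewrite -zmaxE z1.
  split=> [z /spec[Rez /eqP|//]| |v _]; first by rewrite lt_eqF.
    exists (geom_mult P 1); split=> //; rewrite (geom_mult_le_card eigen_block) andbT.
    (* That eigenvalue is 1 here, so the eigenspace is nonzero. *)
    rewrite lt0n mxrank_eq0 -[_ != 0]/(eigenvalue (mxC P)^T 1) eigenvalue_tr -z1.
    exact: zmaxP.
  exact: eigen_block.
have [Pi [APi PiA Pi2 stable Pi_block]] : exists Pi : 'M[R]_n,
    [/\ A *m Pi = 0, Pi *m A = 0, Pi *m Pi = Pi,
        forall z, eigenvalue (mxC (A - Pi)) z -> complex.Re z < 0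
      & forall B i j l, B \in S -> i \in B -> j \in B -> Pi i l = Pi j l].
  case: rhoP => [rho1|[[spec1 [r [_ alg geom]] eigen_block] rho1]].
    (* When all eigenvalues of [P] have real part below 1, [A] is already stable and nothing has to
       be projected out. *)
    exists 0; split; [exact: mulmx0|exact: mul0mx|exact: mulmx0| |]; last first.
      by move=> B i j l _ _ _; rewrite !mxE.
    move=> z; rewrite subr0 eigenvalue_sub1 => /rho_ge.
    by rewrite ReD /= => h; have := le_lt_trans h rho1; rewrite gtrDr.
  have spec z : eigenvalue (mxC P) z -> complex.Re z < 1 \/ z = 1.
    move=> zP; have := rho_ge _ zP; rewrite rho1 le_eqVlt => /predU1P[Rez|]; last by left.
    by right; exact: spec1.
  have [Pi [APi PiA Pi2 stable]] := spectral_projection spec (etrans alg (esym geom)).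
  exists Pi; split; [exact: APi|exact: PiA|exact: Pi2|exact: stable|].
  move=> B i j l BS iB jB.
  pose v := map_mx (real_complex R) (col l Pi).
  suff : v i 0 = v j 0 by rewrite !mxE => -[].
  have [->|v0] := eqVneq v 0; first by rewrite !mxE.
  have [|c ->] := eigen_block v v0.
    rewrite /v /mxC -map_mxM; congr map_mx; apply/eqP.
    rewrite -subr_eq0 -[X in _ - X]mul1mx -mulmxBl colE mulmxA.
    by rewrite -/A APi mul0mx.
  by rewrite (indicator_sum partS _ BS iB) (indicator_sum partS _ BS jB).
move=> x0; split.
  have [y [[my iy] xy]] := state_cvg (traj x0) (hA1 x0) a0 ay a2b APi PiA Pi2 stable.
  have x2 := vL2_state (traj x0) (hA1 x0).
  exists y; split=> //.
    rewrite unlock; under eq_integral do rewrite norm2_sqr.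
    exact: integrable_lty iy.
  (* Back from the real-valued [Ex] to the expectation in the extended reals. *)
  rewrite (_ : (fun s => _) = (fun s => (Ex Pr (fun w => nsq (x x0 s w - y w)))%:E)).
    by apply: cvg_EFin => //; exact: nearW.
  apply/funext => s; rewrite unlock EFin_Ex; last exact: (vL2B (x2 s) (conj my iy)).2.
  by apply: eq_integral => w _; rewrite norm2_sqr.
move=> B i j BS iB jB.
have := consensus_cvg (traj x0) (hA1 x0) a0 ay a2b APi PiA Pi2 stable
  (fun l => Pi_block B i j l BS iB jB).
have x2 := vL2_state (traj x0) (hA1 x0).
have ix k s : L1 Pr (fun w => x x0 s w k 0).
  by apply: L1_sqr; [exact: (x2 s).1|exact: vL2_coord].
move=> xij.
rewrite (_ : (fun s => _) = (fun s => (Ex Pr (fun w => `|x x0 s w i 0 - x x0 s w j 0|))%:E)).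
  by apply: cvg_EFin => //; exact: nearW.
apply/funext => s; rewrite unlock EFin_Ex //.
by apply: L1_norm; apply: L1B.
Qed.
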